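(* Let $R$ be a commutative Noetherian ring with non-zero identity, $\mathfrak a$ an ideal of $R$, $M$ a finitely generated $R$-module, $X$ an arbitrary $R$-module and $n$ a non-negative integer. Let $\mathcal M$ be a Melkersson subcategory with respect to the ideal $\mathfrak a+\operatorname{Ann}_RM$. Then the following statements are equivalent: (i) $H^i_{\mathfrak a+\operatorname{Ann}_RM}(X)$ is in $\mathcal M$ for all $i\le n$. (ii) $H^i_{\mathfrak a}(M,X)$ is in $\mathcal M$ for all $i\le n$. The same equivalence holds with ''for all $i\le n$'' replaced by ''for all $i$'' in both (i) and (ii).
   Context: $H^i_{\mathfrak a}(M,X)=\varinjlim_{k}\operatorname{Ext}^i_R(M/\mathfrak a^kM,X)$ is the $i$-th generalized local cohomology module, and for an ideal $\mathfrak b$, $H^i_{\mathfrak b}(X)=H^i_{\mathfrak b}(R,X)$ is ordinary local cohomology. A Serre subcategory of the category of $R$-modules is a (nonempty) class of $R$-modules such that for every short exact sequence $0\to X'\to X\to X''\to 0$, $X$ is in the class if and only if $X'$ and $X''$ are. A Serre subcategory $\mathcal M$ is a Melkersson subcategory with respect to an ideal $\mathfrak b$ if for every $\mathfrak b$-torsion $R$-module $Y$ (every element of $Y$ is killed by a power of $\mathfrak b$), $0:_Y\mathfrak b\in\mathcal M$ implies $Y\in\mathcal M$. *)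

(* Defs.v *)
From HB Require Import structures.
From mathcomp Require Import all_boot all_algebra.
From mathcomp Require Import generic_quotient ring_quotient boolp freeg.

Set Implicit Arguments.
Unset Strict Implicit.
Unset Printing Implicit Defensive.

Import GRing.Theory.
Local Open Scope ring_scope.
Local Open Scope quotient_scope.

Record submodule (R : comNzRingType) (V : lmodType R) := Submodule {
  submodule_pred :> {pred V};
  submodule_closed : submod_closed submodule_pred
}.

Fact submodule_semi (R : comNzRingType) (V : lmodType R) (S : submodule V) :
  subsemimod_closed S.
Proof. exact: GRing.submod_closed_semi (submodule_closed S). Qed.

HB.instance Definition _ (R : comNzRingType) (V : lmodType R) (S : submodule V) :=
  GRing.isSubmodClosed.Build R V (submodule_pred S) (submodule_semi S).

(* Unlike [idealr], this allows the unit ideal. *)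
Notation ideal R := (submodule (R : comNzRingType)^o).

Section Submodules.
Variables (R : comNzRingType) (V : lmodType R).

Definition submod (S : submodule V) : Type := {x : V | x \in S}.

HB.instance Definition _ (S : submodule V) :=
  SubChoice.copy (submod S) {x : V | x \in S}.
HB.instance Definition _ (S : submodule V) :=
  GRing.SubChoice_isSubLmodule.Build R V _ (submod S)
    (GRing.subsemimodClosedP S).

Definition quotmod (S : submodule V) : Type := Quotient.quot S.

HB.instance Definition _ (S : submodule V) := GRing.Zmodule.on (quotmod S).

Section Quotient.
Variable S : submodule V.

Definition quot_pi : V -> quotmod S := \pi_(Quotient.quot S).

Lemma quot_piP x y : quot_pi x = quot_pi y <-> x - y \in S.
Proof.
rewrite (Quotient.idealrBE S x y); split; first by move=> h; apply/eqP.
by move/eqP.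
Qed.

Lemma quot_pi_surj (q : quotmod S) : exists x, q = quot_pi x.
Proof. by exists (repr q); rewrite /quot_pi reprK. Qed.

Lemma quot_pi_zmod : zmod_morphism quot_pi.
Proof. exact: (raddfB \pi_(Quotient.quot S)). Qed.

HB.instance Definition _ :=
  GRing.isZmodMorphism.Build V (quotmod S) quot_pi quot_pi_zmod.

Definition quot_scale (r : R) (q : quotmod S) : quotmod S :=
  quot_pi (r *: repr (q : Quotient.quot S)).

Lemma quot_scaleE r x : quot_scale r (quot_pi x) = quot_pi (r *: x).
Proof.
apply/quot_piP; rewrite -scalerBr rpredZ //.
by apply/quot_piP; rewrite /quot_pi reprK.
Qed.

Fact quot_scaleA a b q : quot_scale a (quot_scale b q) = quot_scale (a * b) q.
Proof. by have [x ->] := quot_pi_surj q; rewrite !quot_scaleE scalerA. Qed.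

Fact quot_scale1 : left_id 1 quot_scale.
Proof. by move=> q; have [x ->] := quot_pi_surj q; rewrite quot_scaleE scale1r. Qed.

Fact quot_scaleDr : right_distributive quot_scale +%R.
Proof.
move=> a p q; have [x ->] := quot_pi_surj p; have [y ->] := quot_pi_surj q.
by rewrite -raddfD !quot_scaleE scalerDr raddfD.
Qed.

Fact quot_scaleDl q : {morph quot_scale^~ q : a b / a + b}.
Proof.
move=> a b; have [x ->] := quot_pi_surj q.
by rewrite !quot_scaleE scalerDl raddfD.
Qed.

HB.instance Definition _ := GRing.Zmodule_isLmodule.Build R (quotmod S)
  quot_scaleA quot_scale1 quot_scaleDr quot_scaleDl.

Fact quot_pi_scalable : scalable quot_pi.
Proof. by move=> r x; exact: esym (quot_scaleE r x). Qed.

HB.instance Definition _ :=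
  GRing.isScalable.Build R V (quotmod S) _ quot_pi quot_pi_scalable.

End Quotient.
End Submodules.

Section InducedMaps.
Variables (R : comNzRingType) (U V : lmodType R) (f : {linear U -> V}).
Variables (S : submodule U) (T : submodule V).
Hypothesis fST : forall x, x \in S -> f x \in T.

Definition submod_map (x : submod S) : submod T :=
  exist _ (f (val x)) (fST (valP x)).

Fact submod_map_linear : linear submod_map.
Proof. by move=> r x y; apply: val_inj; rewrite /= !linearP. Qed.

HB.instance Definition _ := GRing.isLinear.Build R (submod S) (submod T) _
  submod_map submod_map_linear.

Definition quotmod_map of (forall x, x \in S -> f x \in T) :=
  fun q : quotmod S => quot_pi T (f (repr (q : Quotient.quot S))).

Lemma quotmod_mapE x : quotmod_map fST (quot_pi S x) = quot_pi T (f x).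
Proof.
rewrite /quotmod_map; apply/quot_piP; rewrite -linearB fST //.
by apply/quot_piP; rewrite /quot_pi reprK.
Qed.

Fact quotmod_map_linear : linear (quotmod_map fST).
Proof.
move=> r p q; have [x ->] := quot_pi_surj p; have [y ->] := quot_pi_surj q.
by rewrite -linearP !quotmod_mapE -linearP -linearP.
Qed.

HB.instance Definition _ := GRing.isLinear.Build R (quotmod S) (quotmod T) _
  (quotmod_map fST) quotmod_map_linear.

End InducedMaps.

Section KernelImage.
Variables (R : comNzRingType) (U V : lmodType R) (f : {linear U -> V}).

Fact ker_closed : submod_closed [pred x | f x == 0].
Proof.
split=> [|r x y]; rewrite !inE ?linear0 // => /eqP fx /eqP fy.
by rewrite linearP fx fy scaler0 addr0.
Qed.
Definition ker : submodule U := Submodule ker_closed.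

Fact im_closed : submod_closed [pred y | `[< exists x, f x = y >]].
Proof.
split=> [|r x y]; rewrite !inE.
  by apply/asboolP; exists 0; rewrite linear0.
move=> /asboolP[u <-] /asboolP[v <-]; apply/asboolP.
by exists (r *: u + v); rewrite linearP.
Qed.
Definition im : submodule V := Submodule im_closed.

Variable T : submodule V.
Fact preim_closed : submod_closed [pred x | f x \in T].
Proof.
split=> [|r x y]; rewrite !inE ?linear0 ?rpred0 // => fx fy.
by rewrite linearP rpredD // rpredZ.
Qed.
Definition preim_sub : submodule U := Submodule preim_closed.

End KernelImage.

(* ker g / im f for A --f--> B --g--> C; meant for g \o f = 0. *)
Section Homology.
Variables (R : comNzRingType) (A B C : lmodType R).
Variables (f : {linear A -> B}) (g : {linear B -> C}).

Definition incl (S : submodule B) : {linear submod S -> B} := val.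
Definition bound : submodule (submod (ker g)) := preim_sub (incl (ker g)) (im f).
Definition homology : lmodType R := quotmod bound.

End Homology.

Section HomologyMap.
Variables (R : comNzRingType) (A B C A' B' C' : lmodType R).
Variables (f : {linear A -> B}) (g : {linear B -> C}).
Variables (f' : {linear A' -> B'}) (g' : {linear B' -> C'}).
Variables (u : {linear A -> A'}) (v : {linear B -> B'}) (w : {linear C -> C'}).
Hypotheses (uv : forall x, v (f x) = f' (u x)) (vw : forall x, w (g x) = g' (v x)).

Fact homology_map_ker x : x \in ker g -> v x \in ker g'.
Proof. by rewrite !inE -vw => /eqP->; rewrite linear0. Qed.

Fact homology_map_im (x : submod (ker g)) :
  x \in bound f g -> submod_map homology_map_ker x \in bound f' g'.
Proof.
rewrite !inE => /asboolP[a fa]; apply/asboolP; exists (u a).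
by rewrite -uv fa.
Qed.

Definition homology_map : {linear homology f g -> homology f' g'} :=
  quotmod_map (f := submod_map homology_map_ker) homology_map_im.

End HomologyMap.

Section Hom.
Variable R : comNzRingType.

Definition hom (U V : lmodType R) : Type := {linear U -> V}.

Section HomModule.
Variables U V : lmodType R.

HB.instance Definition _ := gen_eqMixin (hom U V).
HB.instance Definition _ := gen_choiceMixin (hom U V).

Definition hom_fun (f : hom U V) : U -> V := (f : {linear U -> V}).

Lemma hom_eqP (f g : hom U V) : hom_fun f =1 hom_fun g -> f = g.
Proof.
move=> /funext; case: f g => [f cf] [g cg] /= efg.
rewrite /hom_fun /= in efg; subst g.
case: cf cg => [[a] [b]] [[a'] [b']].
by rewrite (Prop_irrelevance a a') (Prop_irrelevance b b').
Qed.

Definition hom_add (f g : hom U V) : hom U V := f \+ g.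
Definition hom_opp (f : hom U V) : hom U V := \- f.
Definition hom_zero : hom U V := \0.
Definition hom_scale (r : R) (f : hom U V) : hom U V := r \*: f.

Fact hom_addA : associative hom_add.
Proof. by move=> f g h; apply: hom_eqP => x; apply: addrA. Qed.
Fact hom_addC : commutative hom_add.
Proof. by move=> f g; apply: hom_eqP => x; apply: addrC. Qed.
Fact hom_add0 : left_id hom_zero hom_add.
Proof. by move=> f; apply: hom_eqP => x; apply: add0r. Qed.
Fact hom_addN : left_inverse hom_zero hom_opp hom_add.
Proof. by move=> f; apply: hom_eqP => x; apply: addNr. Qed.

HB.instance Definition _ :=
  GRing.isZmodule.Build (hom U V) hom_addA hom_addC hom_add0 hom_addN.

Fact hom_scaleA a b f : hom_scale a (hom_scale b f) = hom_scale (a * b) f.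
Proof. by apply: hom_eqP => x; apply: scalerA. Qed.
Fact hom_scale1 : left_id 1 hom_scale.
Proof. by move=> f; apply: hom_eqP => x; apply: scale1r. Qed.
Fact hom_scaleDr : right_distributive hom_scale +%R.
Proof. by move=> a f g; apply: hom_eqP => x; apply: scalerDr. Qed.
Fact hom_scaleDl f : {morph hom_scale^~ f : a b / a + b}.
Proof. by move=> a b; apply: hom_eqP => x; apply: scalerDl. Qed.

HB.instance Definition _ := GRing.Zmodule_isLmodule.Build R (hom U V)
  hom_scaleA hom_scale1 hom_scaleDr hom_scaleDl.

End HomModule.

Definition hom_pre (U U' V : lmodType R) (h : {linear U -> U'})
  (f : hom U' V) : hom U V := hom_fun f \o h.

Fact hom_pre_linear (U U' V : lmodType R) (h : {linear U -> U'}) :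
  linear (@hom_pre U U' V h).
Proof. by move=> r f g; apply: hom_eqP. Qed.

HB.instance Definition _ (U U' V : lmodType R) (h : {linear U -> U'}) :=
  GRing.isLinear.Build R (hom U' V) (hom U V) _ (@hom_pre U U' V h)
    (hom_pre_linear h).

End Hom.

Section FreeModule.
Variable R : comNzRingType.

Section Lift.
Variables (K : choiceType) (V : lmodType R) (f : K -> V).

Definition free_lift : {freeg K / R} -> V := fglift f.

Fact free_lift_zmod : zmod_morphism free_lift.
Proof. exact: lift_is_additive. Qed.

HB.instance Definition _ :=
  GRing.isZmodMorphism.Build {freeg K / R} V free_lift free_lift_zmod.

Lemma free_liftE k x : free_lift << k *g x >> = k *: f x.
Proof. exact: liftU. Qed.

Fact free_lift_scalable : scalable free_lift.
Proof.
move=> r D; rewrite -[in RHS](freeg_sumE D) [LHS]raddf_sum.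
rewrite [in RHS]raddf_sum scaler_sumr; apply: eq_bigr => x _.
by rewrite /= !free_liftE scalerA.
Qed.

HB.instance Definition _ :=
  GRing.isScalable.Build R {freeg K / R} V _ free_lift free_lift_scalable.

End Lift.

Lemma free_ext (K : choiceType) (V : lmodType R)
  (f g : {linear {freeg K / R} -> V}) :
  (forall x, f << x >> = g << x >>) -> f =1 g.
Proof.
move=> fg D; rewrite -(freeg_sumE D) !raddf_sum; apply: eq_bigr => x _.
have -> : << coeff x D *g x >> = coeff x D *: (<< x >> : {freeg K / R}).
  apply/eqP/freeg_eqP => y; rewrite coeffZ !coeffU.
  by rewrite mul1r.
by rewrite [LHS]linearZ [RHS]linearZ /= fg.
Qed.

Definition free (V : lmodType R) : lmodType R := {freeg V / R}.

Definition free_map (U V : lmodType R) (f : {linear U -> V}) :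
  {linear free U -> free V} := free_lift (fun u : U => << f u >> : {freeg V / R}).

Definition aug (V : lmodType R) : {linear free V -> V} := free_lift (@id V).

Lemma aug_surj (V : lmodType R) (v : V) : exists x, aug V x = v.
Proof. by exists << v >>; rewrite /= free_liftE scale1r. Qed.

Lemma aug_map (U V : lmodType R) (f : {linear U -> V}) x :
  aug V (free_map f x) = f (aug U x).
Proof.
apply: (@free_ext _ _ (aug V \o free_map f) (f \o aug U)) => u /=.
by rewrite !free_liftE !scale1r free_liftE scale1r.
Qed.

End FreeModule.

(* The functorial free resolution of V
     ... -> free (syz 2 V) -> free (syz 1 V) -> free (syz 0 V) -> V -> 0
   with syz 0 V = V and syz (n+1) V = ker (free (syz n V) -> syz n V). *)
Section FreeResolution.
Variable R : comNzRingType.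
Implicit Types U V : lmodType R.

Fixpoint syz n V : lmodType R :=
  if n is m.+1 then submod (ker (aug (syz m V))) else V.

Fact syz_map_ker U V (f : {linear U -> V}) x :
  x \in ker (aug U) -> free_map f x \in ker (aug V).
Proof. by rewrite !inE aug_map => /eqP->; rewrite linear0. Qed.

Fixpoint syz_map n U V (f : {linear U -> V}) : {linear syz n U -> syz n V} :=
  if n is m.+1 then submod_map (syz_map_ker (syz_map m f)) else f.

Definition res n V : lmodType R := free (syz n V).

Definition res_d n V : {linear res n.+1 V -> res n V} :=
  incl (ker (aug (syz n V))) \o aug (syz n.+1 V).

Definition res_map n U V (f : {linear U -> V}) : {linear res n U -> res n V} :=
  free_map (syz_map n f).

Lemma res_map_d n U V (f : {linear U -> V}) x :
  res_map n f (res_d n U x) = res_d n V (res_map n.+1 f x).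
Proof. by rewrite /res_d /= aug_map. Qed.

Lemma res_exact0 V x : aug V x = 0 <-> exists y, res_d 0 V y = x.
Proof.
split=> [/eqP x0 | [y <-]]; last first.
  by apply/eqP; have := valP (aug (syz 1 V) y); rewrite inE.
have [y yx] := aug_surj (exist _ x x0 : syz 1 V).
by exists y; rewrite /= yx.
Qed.

Lemma res_exact n V x : res_d n V x = 0 <-> exists y, res_d n.+1 V y = x.
Proof.
split=> [x0 | [y <-]].
  have {}x0 : x \in ker (aug (syz n.+1 V)).
    by rewrite inE; apply/eqP/val_inj.
  have [y yx] := aug_surj (exist _ x x0 : syz n.+2 V).
  by exists y; rewrite /= yx.
rewrite /res_d /=; have := valP (aug (syz n.+2 V) y).
by rewrite inE => /eqP ->.
Qed.

End FreeResolution.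

(* Ext^n(V, X) is the n-th cohomology of the complex hom (res _ V) X. *)
Section Ext.
Variables (R : comNzRingType) (X : lmodType R).
Implicit Types U V : lmodType R.

Definition coch n V : lmodType R := hom (res n V) X.

Definition coch_d n V : {linear coch n V -> coch n.+1 V} :=
  @hom_pre R _ _ X (res_d n V).

Definition coch_map n U V (f : {linear U -> V}) :
  {linear coch n V -> coch n U} := @hom_pre R _ _ X (res_map n f).

Definition Ext n V : lmodType R :=
  if n is m.+1 then homology (coch_d m V) (coch_d m.+1 V)
  else homology (\0 : {linear coch 0 V -> coch 0 V}) (coch_d 0 V).

Fact coch_map_d n U V (f : {linear U -> V}) c :
  coch_map n.+1 f (coch_d n V c) = coch_d n U (coch_map n f c).
Proof.
apply: hom_eqP => x; apply: (congr1 (hom_fun c)).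
exact: esym (res_map_d f x).
Qed.

Fact coch_map_0 U V (f : {linear U -> V}) c :
  coch_map 0 f ((\0 : {linear coch 0 V -> coch 0 V}) c) =
  (\0 : {linear coch 0 U -> coch 0 U}) (coch_map 0 f c).
Proof. exact: linear0. Qed.

Definition Ext_map n U V (f : {linear U -> V}) : {linear Ext n V -> Ext n U} :=
  match n with
  | 0 => homology_map (coch_map_0 f) (coch_map_d f)
  | m.+1 => homology_map (coch_map_d f) (coch_map_d f)
  end.

End Ext.

(* The colimit of L 0 -> L 1 -> L 2 -> ..., as sequences that are eventually
   compatible with the transition maps, modulo those that are eventually zero.
   [dirlim_in_eq], [dirlim_in_surj] and [dirlim_in0] characterize it. *)
Section DirectLimit.
Variable R : comNzRingType.

Section Product.
Variable L : nat -> lmodType R.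

Definition prodmod : Type := forall k, L k.

HB.instance Definition _ := gen_eqMixin prodmod.
HB.instance Definition _ := gen_choiceMixin prodmod.

Definition prodmod_add (x y : prodmod) : prodmod := fun k => x k + y k.
Definition prodmod_opp (x : prodmod) : prodmod := fun k => - x k.
Definition prodmod_zero : prodmod := fun k => 0.
Definition prodmod_scale (r : R) (x : prodmod) : prodmod := fun k => r *: x k.

Fact prodmod_addA : associative prodmod_add.
Proof. by move=> x y z; apply: functional_extensionality_dep => k; apply: addrA. Qed.
Fact prodmod_addC : commutative prodmod_add.
Proof. by move=> x y; apply: functional_extensionality_dep => k; apply: addrC. Qed.
Fact prodmod_add0 : left_id prodmod_zero prodmod_add.
Proof. by move=> x; apply: functional_extensionality_dep => k; apply: add0r. Qed.
Fact prodmod_addN : left_inverse prodmod_zero prodmod_opp prodmod_add.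
Proof. by move=> x; apply: functional_extensionality_dep => k; apply: addNr. Qed.

HB.instance Definition _ := GRing.isZmodule.Build prodmod
  prodmod_addA prodmod_addC prodmod_add0 prodmod_addN.

Fact prodmod_scaleA a b x :
  prodmod_scale a (prodmod_scale b x) = prodmod_scale (a * b) x.
Proof. by apply: functional_extensionality_dep => k; apply: scalerA. Qed.
Fact prodmod_scale1 : left_id 1 prodmod_scale.
Proof. by move=> x; apply: functional_extensionality_dep => k; apply: scale1r. Qed.
Fact prodmod_scaleDr : right_distributive prodmod_scale +%R.
Proof. by move=> a x y; apply: functional_extensionality_dep => k; apply: scalerDr. Qed.
Fact prodmod_scaleDl x : {morph prodmod_scale^~ x : a b / a + b}.
Proof. by move=> a b; apply: functional_extensionality_dep => k; apply: scalerDl. Qed.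

HB.instance Definition _ := GRing.Zmodule_isLmodule.Build R prodmod
  prodmod_scaleA prodmod_scale1 prodmod_scaleDr prodmod_scaleDl.

End Product.

Variables (L : nat -> lmodType R) (phi : forall k, {linear L k -> L k.+1}).

Fact coherent_closed : submod_closed
  [pred x : prodmod L |
     `[< exists K, forall k, (K <= k)%N -> phi k (x k) = x k.+1 >]].
Proof.
split=> [|r x y]; rewrite !inE.
  by apply/asboolP; exists 0%N => k _; rewrite linear0.
move=> /asboolP[K Kx] /asboolP[K' Ky]; apply/asboolP; exists (maxn K K') => k.
by rewrite geq_max => /andP[/Kx xk /Ky yk]; rewrite linearP xk yk.
Qed.
Definition coherent : submodule (prodmod L) := Submodule coherent_closed.

Fact vanishing_closed : submod_closed
  [pred x : submod coherent |
     `[< exists K, forall k, (K <= k)%N -> val x k = 0 >]].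
Proof.
split=> [|r x y]; rewrite !inE; first by apply/asboolP; exists 0%N.
move=> /asboolP[K Kx] /asboolP[K' Ky]; apply/asboolP; exists (maxn K K') => k.
rewrite geq_max => /andP[/Kx xk /Ky yk].
by rewrite -[LHS]/(r *: val x k + val y k) xk yk scaler0 addr0.
Qed.
Definition vanishing : submodule (submod coherent) := Submodule vanishing_closed.

Definition dirlim : lmodType R := quotmod vanishing.

Fixpoint trans k j : L k -> L (j + k)%N :=
  if j is j'.+1 then fun x => phi (j' + k)%N (trans j' x) else id.

Definition dirlim_seq k (x : L k) : prodmod L := fun j =>
  match leqP k j with
  | LeqNotGtn kj => eq_rect _ L (trans (j - k)%N x) _ (subnK kj)
  | GtnNotLeq _ => 0
  end.

Lemma dirlim_seqE k (x : L k) j : dirlim_seq x (j + k)%N = trans j x.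
Proof.
rewrite /dirlim_seq; case: leqP => [kj|]; last by rewrite ltnNge leq_addl.
have e : (j + k - k = j)%N by rewrite addnK.
move: (subnK kj); move: e; move: (j + k - k)%N => i e; subst i => e.
by rewrite (eq_irrelevance e erefl).
Qed.

Fact dirlim_seqS k (x : L k) j :
  (k <= j)%N -> phi j (dirlim_seq x j) = dirlim_seq x j.+1.
Proof.
move=> kj; suff /(_ (j - k)%N) : forall i,
  phi (i + k)%N (dirlim_seq x (i + k)%N) = dirlim_seq x (i + k).+1.
  by rewrite subnK.
by move=> i; rewrite dirlim_seqE; apply: esym (dirlim_seqE x i.+1).
Qed.

Fact dirlim_seq_coherent k (x : L k) : dirlim_seq x \in coherent.
Proof. by apply/asboolP; exists k; apply: dirlim_seqS. Qed.

Definition dirlim_in k (x : L k) : dirlim :=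
  quot_pi vanishing (exist _ (dirlim_seq x) (dirlim_seq_coherent x)).

Fact dirlim_eq (x y : submod coherent) K :
  (forall k, (K <= k)%N -> phi k (val x k) = val x k.+1) ->
  (forall k, (K <= k)%N -> phi k (val y k) = val y k.+1) ->
  val x K = val y K -> quot_pi vanishing x = quot_pi vanishing y.
Proof.
move=> xc yc xy; apply/quot_piP/asboolP; exists K => k.
rewrite -[_ = 0]/(val x k - val y k = 0) => Kk.
suff -> : val x k = val y k by rewrite subrr.
elim: k Kk => [|k IHk]; first by rewrite leqn0 => /eqP <-.
rewrite leq_eqVlt => /orP[/eqP <- // | Kk].
by rewrite -xc // -yc // IHk.
Qed.

Fact dirlim_in_linear k : linear (@dirlim_in k).
Proof.
move=> r x y; rewrite -linearP; apply: (@dirlim_eq _ _ k) => [j|j kj|] /=.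
- exact: dirlim_seqS.
- rewrite -[LHS]/(phi j (r *: dirlim_seq x j + dirlim_seq y j)).
  rewrite -[RHS]/(r *: dirlim_seq x j.+1 + dirlim_seq y j.+1).
  by rewrite linearP !dirlim_seqS.
rewrite -[RHS]/(r *: dirlim_seq x k + dirlim_seq y k).
by rewrite (dirlim_seqE _ 0) (dirlim_seqE x 0) (dirlim_seqE y 0).
Qed.

HB.instance Definition _ k :=
  GRing.isLinear.Build R (L k) dirlim _ (@dirlim_in k) (@dirlim_in_linear k).

Lemma dirlim_in_eq k (x : L k) : dirlim_in (phi k x) = dirlim_in x.
Proof.
apply: (@dirlim_eq _ _ k.+1) => [j|j kj|] /=; first exact: dirlim_seqS.
  by apply: dirlim_seqS; apply: ltnW.
by rewrite (dirlim_seqE (phi k x) 0) (dirlim_seqE x 1).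
Qed.

Lemma dirlim_in_surj (z : dirlim) : exists k (x : L k), dirlim_in x = z.
Proof.
have [s ->] := quot_pi_surj z; have /asboolP[K Ks] := valP s.
exists K, (val s K); apply: (@dirlim_eq _ _ K) => //=.
  by move=> k; apply: dirlim_seqS.
exact: (dirlim_seqE _ 0).
Qed.

Lemma dirlim_in0 k (x : L k) : dirlim_in x = 0 <-> exists j, trans j x = 0.
Proof.
rewrite -(linear0 (quot_pi vanishing)); split=> [/quot_piP/asboolP[K Kx] | [j jx]].
  exists K; rewrite -dirlim_seqE -(Kx _ (leq_addr k K)).
  by rewrite subr0.
apply: (@dirlim_eq _ _ (j + k)%N) => [i ki|i _|] /=; last by rewrite dirlim_seqE.
  by apply: dirlim_seqS; apply: leq_trans ki; apply: leq_addl.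
exact: linear0.
Qed.

End DirectLimit.

Section Ideals.
Variable R : comNzRingType.

Fact topsub_closed (V : lmodType R) : submod_closed [pred x : V | true].
Proof. by []. Qed.
Definition topsub (V : lmodType R) : submodule V := Submodule (topsub_closed V).

Section Product.
Variables (V : lmodType R) (I : ideal R) (S : submodule V).

Fact idealM_closed : submod_closed [pred z : V | `[< exists s : seq (R * V),
  (forall p, p \in s -> (p.1 \in I) && (p.2 \in S)) /\
  z = \sum_(p <- s) p.1 *: p.2 >]].
Proof.
split=> [|r x y]; rewrite !inE.
  by apply/asboolP; exists [::]; split=> //; rewrite big_nil.
move=> /asboolP[s [sIS ->]] /asboolP[t [tIS ->]]; apply/asboolP.
exists ([seq (r * p.1, p.2) | p <- s] ++ t); split=> [p|].
  rewrite mem_cat => /orP[/mapP[q /sIS /andP[qI qS] ->] | /tIS //].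
  by rewrite qS andbT; apply: (@rpredZ R R^o I r q.1).
rewrite big_cat big_map scaler_sumr; congr (_ + _).
by apply: eq_bigr => p _; rewrite scalerA.
Qed.
Definition idealM : submodule V := Submodule idealM_closed.

End Product.

Fixpoint ideal_pow (I : ideal R) k : ideal R :=
  if k is j.+1 then idealM I (ideal_pow I j) else topsub R^o.

Fact idealD_closed (I J : ideal R) : submod_closed [pred z : R^o |
  `[< exists x y, [/\ x \in I, y \in J & z = x + y] >]].
Proof.
split=> [|r x y]; rewrite !inE.
  by apply/asboolP; exists 0, 0; rewrite !rpred0 addr0.
move=> /asboolP[x1 [x2 [x1I x2J ->]]] /asboolP[y1 [y2 [y1I y2J ->]]].
apply/asboolP; exists (r *: x1 + y1), (r *: x2 + y2).
by split; rewrite ?rpredD ?rpredZ // scalerDr addrACA.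
Qed.
Definition idealD (I J : ideal R) : ideal R := Submodule (idealD_closed I J).

Variable V : lmodType R.

Fact Ann_closed :
  submod_closed [pred r : R^o | `[< forall v : V, (r : R) *: v = 0 >]].
Proof.
split=> [|r x y]; rewrite !inE.
  by apply/asboolP => v; rewrite scale0r.
move=> /asboolP xV /asboolP yV; apply/asboolP => v.
by rewrite scalerDl yV addr0 -scalerA xV scaler0.
Qed.
Definition Ann : ideal R := Submodule Ann_closed.

(* The submodule 0 :_V I. *)
Fact colon0_closed (I : ideal R) :
  submod_closed [pred v : V | `[< forall r : R, r \in I -> r *: v = 0 >]].
Proof.
split=> [|r x y]; rewrite !inE.
  by apply/asboolP => a _; rewrite scaler0.
move=> /asboolP xI /asboolP yI; apply/asboolP => a aI.
by rewrite scalerDr yI // addr0 scalerA mulrC -scalerA xI // scaler0.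
Qed.
Definition colon0 (I : ideal R) : submodule V := Submodule (colon0_closed I).

Definition torsion (I : ideal R) : Prop :=
  forall v : V, exists k, forall r : R, r \in ideal_pow I k -> r *: v = 0.

Definition fin_gen : Prop := exists s : seq V,
  forall v, exists c : nat -> R, v = \sum_(i < size s) c i *: s`_i.

End Ideals.

Definition noetherian (R : comNzRingType) : Prop :=
  forall I : ideal R, fin_gen (submod I).

Section LocalCohomology.
Variables (R : comNzRingType) (I : ideal R) (M X : lmodType R).

Definition pow_quot k : lmodType R := quotmod (idealM (ideal_pow I k) (topsub M)).

Fact ideal_pow_sub k (r : R) : r \in ideal_pow I k.+1 -> r \in ideal_pow I k.
Proof.
case/asboolP=> s [sI ->].
elim: s sI => [|p s IHs] sI; first by rewrite big_nil (@rpred0 _ (ideal_pow I k)).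
rewrite big_cons; apply: (@rpredD _ (ideal_pow I k)).
  have /andP[_ pI] := sI p (mem_head _ _).
  exact: (@rpredZ R R^o (ideal_pow I k)).
by apply: IHs => q qs; apply: sI; rewrite inE qs orbT.
Qed.

Fact pow_quot_sub k x : x \in idealM (ideal_pow I k.+1) (topsub M) ->
  idfun x \in idealM (ideal_pow I k) (topsub M).
Proof.
case/asboolP=> s [sI ->]; apply/asboolP; exists s; split=> // p /sI.
by case/andP=> /ideal_pow_sub-> ->.
Qed.

Definition pow_quot_map k : {linear pow_quot k.+1 -> pow_quot k} :=
  quotmod_map (f := idfun) (@pow_quot_sub k).

(* H^i_I(M, X) *)
Definition glc i : lmodType R :=
  @dirlim R (fun k => Ext X i (pow_quot k)) (fun k => Ext_map X i (pow_quot_map k)).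

End LocalCohomology.

Definition lc (R : comNzRingType) (I : ideal R) (X : lmodType R) i : lmodType R :=
  glc I (R^o : lmodType R) X i.

Section Classes.
Variable R : comNzRingType.

Definition short_exact (X' X X'' : lmodType R)
    (f : {linear X' -> X}) (g : {linear X -> X''}) : Prop :=
  [/\ injective f, forall y, exists x, g x = y
    & forall x, g x = 0 <-> exists x', f x' = x].

Definition serre (C : lmodType R -> Prop) : Prop :=
  (exists X, C X) /\
  forall (X' X X'' : lmodType R) (f : {linear X' -> X}) (g : {linear X -> X''}),
    short_exact f g -> C X <-> C X' /\ C X''.

Definition melkersson (C : lmodType R -> Prop) (I : ideal R) : Prop :=
  serre C /\
  forall Y : lmodType R, torsion Y I -> C (submod (colon0 Y I)) -> C Y.

End Classes.

(* Main.v *)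
Require Import Defs.
From HB Require Import structures.
From mathcomp Require Import all_boot all_algebra.
From mathcomp Require Import boolp freeg.

Set Implicit Arguments.
Unset Strict Implicit.
Unset Printing Implicit Defensive.

Import GRing.Theory.
Local Open Scope ring_scope.

(** Why the equivalence holds. Put [I = a + Ann M]. As [Ann M] kills [M], the
    submodules [a^k M] and [I^k M] agree ([powsub_idealD_Ann]), so [H_a(M, X)]
    is [H_I(M, X)], and the claim compares the modules [H^i(V) = H^i_I(V, X)]
    for [V = R] and [V = M].

    The functors [H^i] of a finitely generated module [V] carry a long exact
    sequence. At each level [k], a short exact sequence [U -> V -> W] yields the
    exact sequence [ker -> V/I^k V -> W/I^k W], to which the long exact sequence
    of Ext applies; by the Artin-Rees property the kernels form the same system
    as the modules [U/I^k U], up to a shift of [k] ([ker_pq_factor]). Two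
    consequences are used: [H^i(W) -> H^i(V) -> H^i(U)] is exact
    ([glc_mid_exact]), and the kernel of [H^i(W) -> H^i(V)] is in [C] as soon as
    [H^(i-1)(U)] is ([serre_ker_glc_map]). The argument never varies [X], so no
    injective resolution appears.

    From [R] to [M]: by induction on [i], all [H^i(V)] are in [C] for [V]
    finitely generated, by [0 -> K -> R^r -> V -> 0] ([glc_fg_mem]).

    From [M] to [R]: by induction on [i] all [H^j(V)] with [j < i] are in [C],
    so modulo [C] the functor [H^i] is left exact. Then [H^i(R/J)] is in [C] for
    every ideal [J] containing [Ann M], by noetherian induction
    ([glc_cyclic_mem]); the case of a prime [J] rests on a nonzero map from [M]
    to [R/J] ([hom_to_residue_domain]). With [J = I], left exactness puts
    [0 : I] in [H^i(R)] into [C] ([glc_colon0_mem]), and [H^i(R)] is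
    [I]-torsion, so the Melkersson condition concludes.

    Ext is defined by the free resolution on all elements of a module, which is
    functorial but neither additive nor exact. The comparison theorem repairs
    additivity, and the mapping cone of the two resolutions of a kernel and of
    its ambient module serves as resolution of the quotient; the cone being
    functorial, the connecting homomorphism is natural by construction. *)

(** * Constructing linear maps *)

(** Maps out of quotients and colimits are given by their graphs: linearity is
    then a closure property of the graph, and it remains to see that nothing but
    0 is related to 0. *)
Section LinearRelation.
Variables (R : comNzRingType) (U V : lmodType R) (rho : U -> V -> Prop).
Hypothesis rhoP : forall r x y x' y',
  rho x x' -> rho y y' -> rho (r *: x + y) (r *: x' + y').
Hypothesis rho0 : forall y, rho 0 y -> y = 0.

Lemma linear_rel_uniq x y y' : rho x y -> rho x y' -> y = y'.
Proof.
move=> xy xy'; have := rhoP (-1) xy xy'.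
rewrite !scaleN1r addNr => /rho0 /eqP.
by rewrite [- _ + _]addrC subr_eq0 => /eqP.
Qed.

Lemma linear_of_rel : (forall x, exists y, rho x y) ->
  exists f : {linear U -> V}, forall x, rho x (f x).
Proof.
move=> tot; pose f x := projT1 (cid (tot x)).
have fP x : rho x (f x) by rewrite /f; case: cid.
have lin : linear f.
  by move=> r x y; apply: linear_rel_uniq (fP _) (rhoP r (fP x) (fP y)).
pose F : {linear U -> V} := HB.pack f (GRing.isLinear.Build R U V *:%R f lin).
by exists F.
Qed.

End LinearRelation.

Lemma linear_factor (R : comNzRingType) (U V W : lmodType R)
    (s : {linear U -> V}) (h : {linear U -> W}) :
  (forall v, exists u, s u = v) -> (forall u, s u = 0 -> h u = 0) ->
  exists k : {linear V -> W}, forall u, k (s u) = h u.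
Proof.
move=> sS sh.
case: (@linear_of_rel R V W (fun v w => exists u, s u = v /\ h u = w)).
- move=> r _ _ _ _ [u [<- <-]] [v [<- <-]].
  by exists (r *: u + v); rewrite !linearP.
- by move=> w [u [/sh -> <-]].
- by move=> v; have [u us] := sS v; exists (h u), u.
move=> k kP; exists k => u; have [u' [su' <-]] := kP (s u).
by apply/eqP; rewrite -subr_eq0 -linearB sh // linearB su' subrr.
Qed.

Lemma corestrict (R : comNzRingType) (U V : lmodType R) (S : submodule V)
    (f : {linear U -> V}) :
  (forall x, f x \in S) ->
  exists k : {linear U -> submod S}, forall x, val (k x) = f x.
Proof.
move=> fS; pose k x : submod S := exist (fun y => y \in S) (f x) (fS x).
have lin : linear k by move=> r x y; apply: val_inj; apply: linearP.
pose K : {linear U -> submod S} :=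
  HB.pack k (GRing.isLinear.Build R U (submod S) *:%R k lin).
by exists K.
Qed.

Lemma inj_ker0 (R : comNzRingType) (U V : lmodType R) (f : {linear U -> V}) :
  (forall x, f x = 0 -> x = 0) -> injective f.
Proof.
move=> f0 x y fxy; apply/eqP; rewrite -subr_eq0; apply/eqP/f0.
by rewrite linearB fxy subrr.
Qed.

(** * Serre subcategories *)

Section Serre.
Variables (R : comNzRingType) (C : lmodType R -> Prop).
Hypothesis Cserre : serre C.

Lemma serre_sub (U V : lmodType R) (f : {linear U -> V}) :
  injective f -> C V -> C U.
Proof.
move=> fI CV; have [_ /(_ _ _ _ f (quot_pi (im f)))[|H _]] := Cserre; last by case: (H CV).
split=> // [y|x]; first by have [x ->] := quot_pi_surj y; exists x.
rewrite -(linear0 (quot_pi (im f))) quot_piP subr0.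
by split=> [/asboolP|?]; last apply/asboolP.
Qed.

Lemma serre_quot (U V : lmodType R) (f : {linear U -> V}) :
  (forall y, exists x, f x = y) -> C U -> C V.
Proof.
move=> fS CU; have [_ /(_ _ _ _ (incl (ker f)) f)[|H _]] := Cserre; last by case: (H CU).
split=> // [|x]; first exact: val_inj.
split=> [fx|[[y /eqP fy] <-] //].
have xk : x \in ker f by apply/eqP.
by exists (exist _ x xk).
Qed.

Lemma serre_ker (U V : lmodType R) (f : {linear U -> V}) :
  C (submod (ker f)) -> C V -> C U.
Proof.
move=> CK CV.
have [_ /(_ _ _ _ (incl (ker f)) (quot_pi (ker f)))[|_ CU]] := Cserre.
  split=> // [|y|x]; first exact: val_inj.
    by have [x ->] := quot_pi_surj y; exists x.
  rewrite -(linear0 (quot_pi (ker f))) quot_piP subr0.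
  split=> [xk|[y <-]]; first by exists (exist _ x xk).
  exact: valP.
apply: CU; split=> //.
have [|u fu|k kE] := @linear_factor R U (quotmod (ker f)) V (quot_pi (ker f)) f.
- by move=> y; have [x ->] := quot_pi_surj y; exists x.
- have /quot_piP : quot_pi (ker f) u = quot_pi (ker f) 0 by rewrite fu linear0.
  by rewrite subr0 => /eqP.
apply: (serre_sub (f := k)) CV; apply: inj_ker0 => y.
have [x ->] := quot_pi_surj y; rewrite kE => fx.
by rewrite -(linear0 (quot_pi (ker f))); apply/quot_piP; rewrite subr0; apply/eqP.
Qed.

(** The second components of [rho] form a submodule of [V], and it maps onto [U]
    because only 0 is related to 0. Connecting homomorphisms enter through
    this lemma, by their graphs. *)
Lemma serre_rel (U V : lmodType R) (rho : U -> V -> Prop) :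
  (forall r x y x' y', rho x x' -> rho y y' -> rho (r *: x + y) (r *: x' + y')) ->
  (forall x, exists y, rho x y) -> (forall x, rho x 0 -> x = 0) ->
  C V -> C U.
Proof.
move=> rhoP tot inj CV.
have Scl : submod_closed [pred y : V | `[< exists x, rho x y >]].
  split=> [|r x y]; rewrite !inE.
    have [y y0] := tot 0; apply/asboolP; exists 0.
    by move: (rhoP (-1) _ _ _ _ y0 y0); rewrite !scaleN1r !addNr.
  move=> /asboolP[u ux] /asboolP[v vy]; apply/asboolP.
  by exists (r *: u + v); apply: rhoP.
pose S := Submodule Scl.
have CS : C (submod S) by apply: (serre_sub (f := incl S)) CV; exact: val_inj.
have [|x x0||h hP] := @linear_of_rel R (submod S) U (fun y x => rho x (val y)).
- by move=> r x y u v; rewrite linearP; apply: rhoP.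
- by apply: inj; rewrite linear0 in x0.
- by move=> y; have /asboolP := valP y.
apply: (serre_quot (f := h)) CS => u; have [v uv] := tot u.
have vS : v \in S by apply/asboolP; exists u.
exists (exist _ v vS); apply/eqP; rewrite -subr_eq0; apply/eqP/inj.
have := rhoP (-1) _ _ _ _ uv (hP (exist _ v vS)).
by rewrite !scaleN1r addNr addrC.
Qed.

Lemma serre_mid (Z U V : lmodType R) (f : {linear Z -> U}) (g : {linear U -> V}) :
  (forall x, g x = 0 -> exists z, f z = x) -> C Z -> C V -> C U.
Proof.
move=> ex CZ CV; apply: (serre_ker (f := g)) CV.
apply: (serre_rel (rho := fun (x : submod (ker g)) z => f z = val x)) CZ.
- by move=> r x y x' y' fx fy; rewrite linearP fx fy.
- by move=> x; apply: ex; apply/eqP; exact: (valP x).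
- by move=> x; rewrite linear0 => x0; apply: val_inj.
Qed.

Lemma serre_mid_sub (Z U V : lmodType R) (f : {linear Z -> U})
    (g : {linear U -> V}) (S : submodule U) (T : submodule V) :
  (forall x, g x = 0 -> exists z, f z = x) -> (forall x, x \in S -> g x \in T) ->
  C Z -> C (submod T) -> C (submod S).
Proof.
move=> ex gST CZ CT; apply: (serre_ker (f := submod_map gST)) CT.
apply: (serre_rel (rho := fun (x : submod (ker (submod_map gST))) z =>
  f z = val (val x))) CZ.
- by move=> r x y x' y' fx fy; rewrite linearP fx fy.
- by move=> x; apply: ex; have /eqP/(congr1 val) := valP x.
- by move=> x; rewrite linear0 => x0; do 2!apply: val_inj.
Qed.

End Serre.

(** * Finitely generated and noetherian modules *)

Definition surj (A B : Type) (f : A -> B) : Prop := forall y, exists x, f x = y.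

Lemma kerP (R : comNzRingType) (U V : lmodType R) (f : {linear U -> V}) x :
  reflect (f x = 0) (x \in ker f).
Proof. exact: eqP. Qed.

Lemma imP (R : comNzRingType) (U V : lmodType R) (f : {linear U -> V}) y :
  reflect (exists x, f x = y) (y \in im f).
Proof. exact: asboolP. Qed.

Section Maps.
Variable R : comNzRingType.
Implicit Types U V W : lmodType R.

Definition scale_at V (v : V) (r : R^o) : V := (r : R) *: v.
Fact scale_at_linear V (v : V) : linear (scale_at v).
Proof. by move=> r x y; rewrite /scale_at scalerDl scalerA. Qed.
HB.instance Definition _ V (v : V) :=
  GRing.isLinear.Build R R^o V _ (scale_at v) (scale_at_linear v).

Definition copair U V W (f : {linear U -> W}) (g : {linear V -> W})
  (x : (U * V)%type) : W := f x.1 + g x.2.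
Fact copair_linear U V W (f : {linear U -> W}) (g : {linear V -> W}) :
  linear (copair f g).
Proof. by move=> r x y; rewrite /copair !linearP scalerDr addrACA. Qed.
HB.instance Definition _ U V W (f : {linear U -> W}) (g : {linear V -> W}) :=
  GRing.isLinear.Build R (U * V)%type W _ (copair f g) (copair_linear f g).

Definition inl_lin U V (x : U) : (U * V)%type := (x, 0).
Arguments inl_lin : clear implicits.
Fact inl_lin_linear U V : linear (inl_lin U V).
Proof. by move=> r x y; rewrite /inl_lin; congr (_, _); rewrite /= scaler0 addr0. Qed.
HB.instance Definition _ U V :=
  GRing.isLinear.Build R U (U * V)%type _ (inl_lin U V) (@inl_lin_linear U V).

Definition inr_lin U V (y : V) : (U * V)%type := (0, y).
Arguments inr_lin : clear implicits.
Fact inr_lin_linear U V : linear (inr_lin U V).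
Proof. by move=> r x y; rewrite /inr_lin; congr (_, _); rewrite /= scaler0 addr0. Qed.
HB.instance Definition _ U V :=
  GRing.isLinear.Build R V (U * V)%type _ (inr_lin U V) (@inr_lin_linear U V).

Definition fst_lin U V : {linear (U * V)%type -> U} := fst.
Definition snd_lin U V : {linear (U * V)%type -> V} := snd.

Definition projective (P : lmodType R) : Prop :=
  forall U V (g : {linear U -> V}) (h : {linear P -> V}),
    (forall x, exists u, g u = h x) ->
  exists k : {linear P -> U}, forall x, g (k x) = h x.

Lemma projective_regular : projective R^o.
Proof.
move=> U V g h lift; have [u gu] := lift 1.
exists (scale_at u) => x; rewrite /= /scale_at linearZ gu -linearZ.
by congr (h _); exact: mulr1.
Qed.

Lemma projective_prod P Q : projective P -> projective Q -> projective (P * Q)%type.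
Proof.
move=> pP pQ U V g h lift.
have [x|k1 k1P] := pP U V g (h \o inl_lin P Q); first exact: lift.
have [x|k2 k2P] := pQ U V g (h \o inr_lin P Q); first exact: lift.
exists (copair k1 k2) => -[x y] /=; rewrite /copair linearD k1P k2P /= -linearD.
by congr (h _); rewrite /inl_lin /inr_lin; congr (_, _); rewrite /= ?addr0 ?add0r.
Qed.

Lemma projective_free V : projective (Defs.free V).
Proof.
move=> U W g h lift; pose k0 v := projT1 (cid (lift (<< v >> : {freeg V / R}))).
exists (free_lift k0).
apply: (@free_ext _ _ _ (g \o free_lift k0) h) => x /=.
by rewrite free_liftE scale1r /k0; case: cid.
Qed.

(** The free module of rank [r.+1]: with the ring itself as base case, inductions
    on the rank start from [R] and not from the zero module. *)
Fixpoint ringpow r : lmodType R := if r is r'.+1 then (R^o * ringpow r')%type else R^o.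

Lemma projective_ringpow r : projective (ringpow r).
Proof.
elim: r => [|r IHr]; first exact: projective_regular.
by apply: projective_prod => //; apply: projective_regular.
Qed.

Definition fg V : Prop := exists r (q : {linear ringpow r -> V}), surj q.

Lemma fin_gen_fg V : fin_gen V <-> fg V.
Proof.
split=> [[s sP]|[r [q qS]]].
  suff [r [q qP]] : exists r (q : {linear ringpow r -> V}),
      forall c : nat -> R, exists u, q u = \sum_(i < size s) c i *: s`_i.
    exists r, q => v; have [c ->] := sP v; exact: qP.
  elim: s {sP} => [|x s [r [q qP]]].
    by exists 0%N, \0 => c; exists 0; rewrite big_ord0.
  exists r.+1, (copair (scale_at x) q) => c.
  have [u qu] := qP (fun i => c i.+1).
  by exists (c 0%N : R^o, u); rewrite /= /copair /= qu big_ord_recl.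
suff [s sP] : exists s : seq V,
    forall u, exists c : nat -> R, q u = \sum_(i < size s) c i *: s`_i.
  by exists s => v; have [u <-] := qS v; exact: sP.
elim: r q {qS} => [|r IHr] q.
  exists [:: q 1] => u; exists (fun=> u).
  by rewrite big_ord_recl big_ord0 addr0 -linearZ; congr (q _); rewrite /= [RHS]mulr1.
have [s sP] := IHr (q \o inr_lin R^o (ringpow r)).
exists (q (1, 0) :: s) => -[x y]; have [c qy] := sP y.
exists (fun i => if i is j.+1 then c j else x).
rewrite /= big_ord_recl /= -qy -linearZ /= -linearD; congr (q _).
rewrite /inr_lin; congr (_, _); rewrite /= ?scaler0 ?add0r //.
by rewrite addr0 [RHS]mulr1.
Qed.

Lemma fg_quot U V (f : {linear U -> V}) : surj f -> fg U -> fg V.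
Proof.
move=> fS [r [q qS]]; exists r, (f \o q) => v.
by have [u <-] := fS v; have [w <-] := qS u; exists w.
Qed.

Lemma ringpow_sum r1 r2 V (q1 : {linear ringpow r1 -> V}) (q2 : {linear ringpow r2 -> V}) :
  exists r (q : {linear ringpow r -> V}), forall u1 u2, exists u, q u = q1 u1 + q2 u2.
Proof.
elim: r1 q1 => [|r1 IHr] q1.
  by exists r2.+1, (copair q1 q2) => u1 u2; exists (u1 : R^o, u2).
have [r [q qP]] := IHr (q1 \o inr_lin R^o (ringpow r1)).
exists r.+1, (copair (q1 \o inl_lin R^o (ringpow r1)) q) => -[x u1] u2.
have [u qu] := qP u1 u2; exists (x : R^o, u).
rewrite /= /copair qu /= addrA -linearD; congr (q1 _ + _).
by rewrite /inl_lin /inr_lin; congr (_, _); rewrite /= ?addr0 ?add0r.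
Qed.

Definition noeth V : Prop := forall S : submodule V, fg (submod S).

Lemma noeth_quot V W (g : {linear V -> W}) : surj g -> noeth V -> noeth W.
Proof.
move=> gS nV S; pose S' := preim_sub g S.
have gP x : x \in S' -> g x \in S by [].
apply: (fg_quot (f := submod_map gP)) (nV S') => -[w wS].
have [v gv] := gS w; have vS : v \in S' by rewrite inE gv.
by exists (exist _ v vS); apply: val_inj.
Qed.

Lemma noeth_ext U V W (f : {linear U -> V}) (g : {linear V -> W}) :
  (forall x, g x = 0 -> exists y, f y = x) -> noeth U -> noeth W -> noeth V.
Proof.
move=> ex nU nW S.
have fP x : x \in preim_sub f S -> f x \in S by [].
pose gS := g \o incl S.
have gP (x : submod S) : x \in topsub (submod S) -> gS x \in im gS.
  by move=> _; apply/imP; exists x.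
have [r1 [q1 q1S]] := nU (preim_sub f S).
have [r2 [q2 q2S]] := nW (im gS).
have [x|k kP] := projective_ringpow (g := gS) (h := incl (im gS) \o q2).
  by have /imP[y yE] := valP (q2 x); exists y.
have [r [q qP]] := ringpow_sum (submod_map fP \o q1) k.
exists r, q => y.
have [u2 u2y] := q2S (exist _ (gS y) (gP y isT)).
have [|x fx] := ex (val y - val (k u2)).
  rewrite linearB; apply/eqP; rewrite subr_eq0; apply/eqP.
  by have := kP u2; rewrite /gS /= u2y.
have xS : x \in preim_sub f S by rewrite inE fx rpredB //; exact: valP.
have [u1 u1x] := q1S (exist _ x xS).
have [u qu] := qP u1 u2; exists u; rewrite qu /= u1x.
by apply: val_inj; rewrite /= fx subrK.
Qed.

Lemma noeth_ringpow r : noetherian R -> noeth (ringpow r).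
Proof.
move=> nR; have nR' : noeth R^o by move=> I; apply/fin_gen_fg; exact: nR.
elim: r => [//|r IHr]; apply: (noeth_ext (f := inr_lin _ _) (g := fst_lin _ _)) => //.
by move=> [x y] /= x0; exists y; rewrite /inr_lin -x0.
Qed.

Lemma fg_noeth V : noetherian R -> fg V -> noeth V.
Proof. by move=> nR [r [q qS]]; apply: (noeth_quot qS); apply: noeth_ringpow. Qed.

(** * Maximal submodules and noetherian induction *)

Lemma chain_ringpow V (S : nat -> submodule V) r (q : {linear ringpow r -> V}) :
  (forall m n x, (m <= n)%N -> x \in S m -> x \in S n) ->
  (forall u, exists m, q u \in S m) -> exists m, forall u, q u \in S m.
Proof.
move=> inc; elim: r q => [|r IHr] q qS.
  have [m q1] := qS 1; exists m => u.
  by rewrite (_ : u = u *: 1) ?linearZ ?rpredZ // /= [RHS]mulr1.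
have [u|m1 m1P] := IHr (q \o inr_lin R^o (ringpow r)); first exact: qS.
have [m2 m2P] := qS (1, 0); exists (maxn m1 m2) => -[x u].
rewrite (_ : (x, u) = x *: (1, 0) + inr_lin R^o (ringpow r) u); last first.
  rewrite /inr_lin; congr (_, _); rewrite /= ?scaler0 ?add0r // addr0.
  by rewrite [RHS]mulr1.
rewrite linearD linearZ rpredD ?rpredZ //.
  by apply: inc m2P; apply: leq_maxr.
by apply: inc (m1P u); apply: leq_maxl.
Qed.

(** Otherwise there is a strictly increasing chain of submodules; its union is
    finitely generated, so it is reached at a finite stage. *)
Lemma noeth_max V (P : submodule V -> Prop) S0 : noeth V -> P S0 ->
  exists2 S : submodule V, P S &
    forall T : submodule V, P T -> {subset S <= T} -> {subset T <= S}.
Proof.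
move=> nV PS0; apply: contrapT => nomax.
have next (S : {S | P S}) :
    {T : {T | P T} | {subset sval S <= sval T} /\ ~ {subset sval T <= sval S}}.
  apply: cid; case: S => S PS /=; apply: contrapT => nS.
  apply: nomax; exists S => // T PT ST; apply: contrapT => TS.
  by apply: nS; exists (exist _ T PT).
pose S n := iter n (fun S => sval (next S)) (exist _ S0 PS0).
have inc m n x : (m <= n)%N -> x \in sval (S m) -> x \in sval (S n).
  move/subnK <-; elim: (n - m)%N => [//|k IHk] xS; rewrite addSn /=.
  by case: (next _) => T /= [+ _]; apply; apply: IHk.
have cl : submod_closed [pred x : V | `[< exists n, x \in sval (S n) >]].
  split=> [|r x y]; rewrite !inE; first by apply/asboolP; exists 0%N; apply: rpred0.
  move=> /asboolP[n nx] /asboolP[m my]; apply/asboolP; exists (maxn n m).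
  rewrite rpredD ?rpredZ //; first by apply: inc nx; apply: leq_maxl.
  by apply: inc my; apply: leq_maxr.
have [r [q qS]] := nV (Submodule cl).
have [//|u|m mP] := @chain_ringpow V (fun n => sval (S n)) r (incl _ \o q).
  by have /asboolP := valP (q u).
have /= := svalP (next (S m)); case=> _; apply=> x xS.
have xU : x \in Submodule cl by apply/asboolP; exists m.+1.
by have [u qu] := qS (exist _ x xU); have := mP u; rewrite /= qu.
Qed.

Lemma ideal_ind (P : ideal R -> Prop) : noetherian R ->
  (forall I : ideal R, (forall J : ideal R, {subset I <= J} ->
     (exists2 y, y \in J & y \notin I) -> P J) -> P I) ->
  forall I : ideal R, P I.
Proof.
move=> nR ind I; apply: contrapT => nPI.
have [|J nPJ maxJ] := @noeth_max R^o (fun I => ~ P I) I _ nPI.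
  exact: (@noeth_ringpow 0 nR).
apply/nPJ/ind => K JK [y yK yJ]; apply: contrapT => nPK.
by move: (maxJ K nPK JK y yK) => yJ'; rewrite yJ' in yJ.
Qed.

End Maps.

Arguments inl_lin {R} U V.
Arguments inr_lin {R} U V.
Arguments fst_lin {R} U V.
Arguments snd_lin {R} U V.

(** * The Artin-Rees property for powers of an ideal *)

Section Powers.
Variable R : comNzRingType.
Implicit Types (I J : ideal R) (U V : lmodType R).

Lemma idealM_mem V I (S : submodule V) (a : R) v :
  a \in I -> v \in S -> a *: v \in idealM I S.
Proof.
move=> aI vS; apply/asboolP; exists [:: (a, v)]; split.
  by move=> p; rewrite inE => /eqP->; rewrite aI vS.
by rewrite big_seq1.
Qed.

Lemma idealM_sub V I (S T : submodule V) :
  (forall (a : R) v, a \in I -> v \in S -> a *: v \in T) ->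
  {subset idealM I S <= T}.
Proof.
move=> IST _ /asboolP[s [sIS ->]]; rewrite big_seq; apply: rpred_sum => p ps.
by have /andP[] := sIS p ps; apply: IST.
Qed.

Definition colon I (x : R) : ideal R := preim_sub (scale_at (x : R^o)) I.
Definition adjoin I (x : R) : ideal R := idealD I (im (scale_at (x : R^o))).

Lemma colonE I x (y : R) : (y \in colon I x) = (y * x \in I).
Proof. by []. Qed.

Lemma adjoinP I x z :
  reflect (exists2 y, y \in I & exists r : R, z = y + r * x) (z \in adjoin I x).
Proof.
apply: (iffP (asboolP _)) => [[y [_ [yI /imP[r <-] ->]]]|[y yI [r ->]]].
  by exists y => //; exists r.
by exists y, (r * x); split=> //; apply/imP; exists r.
Qed.

Lemma mem_adjoin I x : x \in adjoin I x.
Proof. by apply/adjoinP; exists 0; [exact: rpred0|exists 1; rewrite add0r mul1r]. Qed.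

Lemma sub_adjoin I x : {subset I <= adjoin I x}.
Proof. by move=> y yI; apply/adjoinP; exists y => //; exists 0; rewrite mul0r addr0. Qed.

Lemma ideal_mulr I (x y : R) : x \in I -> y * x \in I.
Proof. exact: (@rpredZ R R^o I y x). Qed.

Lemma ideal_mull I (x y : R) : x \in I -> x * y \in I.
Proof. by rewrite mulrC; apply: ideal_mulr. Qed.

Lemma ideal_powD I J p q :
  (forall a d : R, a \in ideal_pow I p -> d \in ideal_pow I q -> a * d \in J) ->
  {subset ideal_pow I (p + q) <= J}.
Proof.
elim: p J => [|p IHp] J H.
  by move=> x xq; rewrite -[x](mul1r (x : R)); apply: H.
rewrite addSn; apply: idealM_sub => a z aI zpq.
rewrite -[_ *: _]/(a * z) mulrC -colonE; apply: IHp z zpq => b d bp dq.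
rewrite colonE mulrAC [b * a]mulrC; apply: H => //.
exact: idealM_mem.
Qed.

Lemma ideal_pow1 I : {subset ideal_pow I 1 <= I}.
Proof. by apply: idealM_sub => a v aI _; apply: ideal_mull. Qed.

Lemma ideal_pow_mono I p q : (p <= q)%N -> {subset ideal_pow I q <= ideal_pow I p}.
Proof.
move/subnK<-; elim: (q - p)%N => [//|k IHk] x xI; apply: IHk.
exact: ideal_pow_sub xI.
Qed.

(** Noetherian induction on [J]. If [J] is proper and [x] in [I] is not in [J],
    let [v] be the last power of [x] outside [J], so that [v * x] is in [J]. A
    power of [I] lies in each of the strictly larger ideals [J + (x)] and
    [J + (v)], and the product of these two lies in [J]. *)
Lemma ideal_pow_in I J : noetherian R ->
  (forall x : R, x \in I -> exists m, x ^+ m \in J) ->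
  exists m, {subset ideal_pow I m <= J}.
Proof.
move=> nR; move: J; apply: (ideal_ind nR) => J IHJ IJ.
have [J1|J1] := boolP ((1 : R) \in J).
  by exists 0%N => x _; rewrite -[x](mulr1 (x : R)); apply: ideal_mulr.
case: (pselect {subset I <= J}) => [sIJ|nIJ].
  by exists 1%N => x /ideal_pow1; apply: sIJ.
have [x xI xJ] : exists2 x : R, x \in I & x \notin J.
  apply: contrapT => nx; apply: nIJ => x xI; apply: contrapT => /negP xJ.
  by apply: nx; exists x.
have [[|m] xm min] := ex_minnP (IJ x xI); first by case/negP: J1.
have vJ : x ^+ m \notin J by apply/negP => /min; rewrite ltnn.
have larger y : y \notin J -> exists m, {subset ideal_pow I m <= adjoin J y}.
  move=> yJ; apply: IHJ => [||z zI]; first exact: sub_adjoin.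
    by exists y => //; apply: mem_adjoin.
  by have [k zk] := IJ z zI; exists k; apply: sub_adjoin.
have [p pP] := larger _ xJ; have [q qP] := larger _ vJ.
exists (p + q)%N; apply: ideal_powD => a d /pP/adjoinP[y yJ [r ->]] /qP.
move=> /adjoinP[z zJ [t ->]]; rewrite mulrDl; apply: (@rpredD _ J).
  exact: ideal_mull.
rewrite mulrDr; apply: (@rpredD _ J); first exact: ideal_mulr.
by rewrite mulrACA -exprS; apply: ideal_mulr.
Qed.

Definition powsub I V k : submodule V := idealM (ideal_pow I k) (topsub V).

Lemma powsub_mono I V p q : (p <= q)%N -> {subset powsub I V q <= powsub I V p}.
Proof.
move=> pq; apply: idealM_sub => a v aI _; apply: idealM_mem => //.
exact: ideal_pow_mono aI.
Qed.

Lemma powsub_map I U V (f : {linear U -> V}) k x :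
  x \in powsub I U k -> f x \in powsub I V k.
Proof.
have: {subset powsub I U k <= preim_sub f (powsub I V k)}; last exact.
by apply: idealM_sub => a v aI _; rewrite inE linearZ; apply: idealM_mem.
Qed.

Lemma powsub_surj I U V (f : {linear U -> V}) k y : surj f ->
  y \in powsub I V k -> exists2 x, x \in powsub I U k & f x = y.
Proof.
move=> fS.
have cl : submod_closed [pred y : V | `[< exists2 x, x \in powsub I U k & f x = y >]].
  split=> [|r u v]; rewrite !inE.
    by apply/asboolP; exists 0; rewrite ?linear0 ?rpred0.
  move=> /asboolP[x xk <-] /asboolP[z zk <-]; apply/asboolP.
  by exists (r *: x + z); rewrite ?linearP // rpredD // rpredZ.
suff H: {subset powsub I V k <= Submodule cl} by move/H => /asboolP.
apply: idealM_sub => a v aI _; have [u <-] := fS v; apply/asboolP.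
by exists (a *: u); rewrite ?linearZ //; apply: idealM_mem.
Qed.

(** Take [L] maximal among the submodules of [V] that contain [f (J U)] and
    meet [f U] in nothing else. For [x] in [J] the submodules [L : x ^ m]
    stabilize, and then [L + x ^ m V] also meets [f U] only in [f (J U)]: if
    [f y = l + x ^ m v], then [x f y] is in [L], so [x ^ m.+1 v] is, so
    [x ^ m v] is. Hence [x ^ m V] lies in [L]; so does [J ^ k V] for some [k]. *)
Lemma artin_rees_ideal U V (f : {linear U -> V}) J :
  noetherian R -> noeth V -> injective f ->
  exists m, forall y, f y \in powsub J V m -> y \in idealM J (topsub U).
Proof.
move=> nR nV fI; set W := idealM J (topsub U).
pose P (L : submodule V) :=
  (forall y, y \in W -> f y \in L) /\ (forall y, f y \in L -> y \in W).
have [|L [WL LW] maxL] := @noeth_max R V P (im (f \o incl W)) nV.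
  split=> y; first by move=> yW; apply/imP; exists (exist _ y yW).
  by move/imP=> [z /fI <-]; apply: valP.
pose scal (r : R) : {linear V -> V} := r \*: idfun.
have xV (x : R) : x \in J -> exists m, forall v, x ^+ m *: v \in L.
  move=> xJ; pose Q (T : submodule V) := exists m, T = preim_sub (scal (x ^+ m)) L.
  have [|_ [m ->] maxm] := @noeth_max R V Q (preim_sub (scal (x ^+ 0)) L) nV.
    by exists 0%N.
  have stab v : x ^+ m.+1 *: v \in L -> x ^+ m *: v \in L.
    apply: (maxm (preim_sub (scal (x ^+ m.+1)) L)); first by exists m.+1.
    move=> z; rewrite !inE /= => zL.
    by rewrite exprS -scalerA rpredZ.
  exists m => v.
  have cl : submod_closed
      [pred z | `[< exists2 l, l \in L & exists v, z = l + x ^+ m *: v >]].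
    split=> [|r a b]; rewrite !inE.
      by apply/asboolP; exists 0; [exact: rpred0|exists 0; rewrite scaler0 addr0].
    move=> /asboolP[l lL [c ->]] /asboolP[l' lL' [c' ->]]; apply/asboolP.
    exists (r *: l + l'); first by rewrite rpredD // rpredZ.
    by exists (r *: c + c'); rewrite !scalerDr !scalerA addrACA mulrC.
  apply: (maxL (Submodule cl)) => [|z zL|]; first split=> y.
  - move=> /WL yL; apply/asboolP; exists (f y) => //.
    by exists 0; rewrite scaler0 addr0.
  - move=> /asboolP[l lL [c fy]]; apply: LW; rewrite fy rpredD //; apply: stab.
    rewrite exprS -scalerA.
    have -> : x ^+ m *: c = f y - l by rewrite fy addrC addKr.
    rewrite scalerBr; apply: rpredB; last exact: rpredZ.
    rewrite -linearZ; apply: WL.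
    exact: idealM_mem.
  - by apply/asboolP; exists z => //; exists 0; rewrite scaler0 addr0.
  - by apply/asboolP; exists 0; [exact: rpred0|exists v; rewrite add0r].
have cl : submod_closed [pred r : R^o | `[< forall v, (r : R) *: v \in L >]].
  split=> [|r a b]; rewrite !inE.
    by apply/asboolP => v; rewrite scale0r rpred0.
  move=> /asboolP aL /asboolP bL; apply/asboolP => v.
  rewrite scalerDl -scalerA; apply: rpredD; last exact: bL.
  by apply: rpredZ; exact: aL.
have [x xJ|m mP] := @ideal_pow_in J (Submodule cl) nR.
  by have [m mL] := xV x xJ; exists m; apply/asboolP; exact: mL.
exists m => y fy; apply: LW; move: fy; apply: idealM_sub => a v /mP /asboolP aL _.
exact: aL.
Qed.

(** The previous lemma for the ideal [I ^ j], whose [m]-th power contains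
    [I ^ (m * j)]. *)
Lemma artin_rees I U V (f : {linear U -> V}) j :
  noetherian R -> noeth V -> injective f ->
  exists2 m, (j <= m)%N & forall y, f y \in powsub I V m -> y \in powsub I U j.
Proof.
move=> nR nV fI; have [m mP] := @artin_rees_ideal U V f (ideal_pow I j) nR nV fI.
exists (j + m * j)%N; first exact: leq_addr.
move=> y fy; apply: mP; move: fy; apply: idealM_sub => a v aI _.
apply: idealM_mem => //.
suff: {subset ideal_pow I (m * j) <= ideal_pow (ideal_pow I j) m}.
  by apply; apply: ideal_pow_mono aI; apply: leq_addl.
elim: {a aI} m => [//|m IHm]; rewrite mulSn; apply: ideal_powD => a d aI dI.
by apply: idealM_mem => //; apply: IHm.
Qed.

End Powers.

(** * Comparison of resolutions *)

Lemma dependent_choice (A : nat -> Type) (ok : forall n, A n -> Prop)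
    (rel : forall n, A n -> A n.+1 -> Prop) (a0 : A 0%N) :
  ok 0%N a0 ->
  (forall n a, ok n a -> exists b, ok n.+1 b /\ rel n a b) ->
  exists s : forall n, A n, s 0%N = a0 /\ forall n, rel n (s n) (s n.+1).
Proof.
move=> ok0 step.
have next n (a : {a | ok n a}) : {b : {b | ok n.+1 b} | rel n (sval a) (sval b)}.
  apply: cid; have [b [okb ab]] := step n _ (svalP a).
  by exists (exist _ b okb).
pose s := fix s n : {a | ok n a} :=
  if n is m.+1 then sval (next m (s m)) else exist _ a0 ok0.
by exists (fun n => sval (s n)); split=> // n /=; case: (next n (s n)).
Qed.

Lemma linear_ext (R : comNzRingType) (U V : lmodType R) (f g : {linear U -> V}) :
  f =1 g -> f = g.
Proof. exact: hom_eqP. Qed.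

Section Complexes.
Variable R : comNzRingType.
Implicit Types U V W : lmodType R.

(** Complexes are augmented: the module in degree 0 is the resolved one. *)
Definition diff (Q : nat -> lmodType R) := forall n, {linear Q n.+1 -> Q n}.

Definition exact_cpx Q (d : diff Q) : Prop :=
  surj (d 0%N) /\ forall n x, d n x = 0 <-> exists y, d n.+1 y = x.

Definition proj_cpx (Q : nat -> lmodType R) : Prop := forall n, projective (Q n.+1).

Definition chain_map Q (d : diff Q) Q' (d' : diff Q')
    (phi : forall n, {linear Q n -> Q' n}) : Prop :=
  forall n x, d' n (phi n.+1 x) = phi n (d n x).

Section Comparison.
Variables (Q Q' : nat -> lmodType R) (d : diff Q) (d' : diff Q').
Hypotheses (projQ : proj_cpx Q) (dd : forall n x, d n (d n.+1 x) = 0).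
Hypothesis exQ' : exact_cpx d'.

Lemma chain_lift (h : {linear Q 0%N -> Q' 0%N}) :
  exists phi, chain_map d d' phi /\ phi 0%N = h.
Proof.
have [surj0 ex] := exQ'.
(* [ok] is the lifting condition for the next step; exactness propagates it. *)
pose ok n (f : {linear Q n -> Q' n}) :=
  forall x, exists y, d' n y = f (d n x).
pose rel n (f : {linear Q n -> Q' n}) (g : {linear Q n.+1 -> Q' n.+1}) :=
  forall x, d' n (g x) = f (d n x).
have [|n f okf|phi [phi0 phiP]] := @dependent_choice _ ok rel h.
- by move=> x; apply: surj0.
- have [g gP] := projQ (g := d' n) (h := f \o d n) okf.
  by exists g; split=> // x; apply/ex; rewrite gP /= dd linear0.
by exists phi.
Qed.

Lemma chain_homotopy phi psi :
  chain_map d d' phi -> chain_map d d' psi -> phi 0%N = psi 0%N ->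
  exists s : forall n, {linear Q n -> Q' n.+1}, (forall x, s 0%N x = 0) /\
    forall n x, phi n.+1 x - psi n.+1 x = d' n.+1 (s n.+1 x) + s n (d n x).
Proof.
move=> phiP psiP e0; have [surj0 ex] := exQ'.
pose ok n (s : {linear Q n -> Q' n.+1}) := forall x, exists y,
  d' n.+1 y = phi n.+1 x - psi n.+1 x - s (d n x).
pose rel n (s : {linear Q n -> Q' n.+1}) (t : {linear Q n.+1 -> Q' n.+2}) :=
  forall x, phi n.+1 x - psi n.+1 x = d' n.+1 (t x) + s (d n x).
have [|n s oks|s [s0 sP]] := @dependent_choice _ ok rel \0.
- by move=> x; apply/ex; rewrite subr0 linearB phiP psiP e0 subrr.
- pose w := (phi n.+1 \- psi n.+1) \- (s \o d n).
  have [t tP] := projQ (g := d' n.+1) (h := w) oks.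
  exists t; split=> x; last by rewrite tP /= subrK.
  apply/ex; rewrite !linearB phiP psiP tP /= dd linear0 subr0.
  by rewrite subrr.
by exists s; split=> // x; rewrite s0.
Qed.

End Comparison.

(** * Ext from an arbitrary projective resolution *)

Definition ares V n : lmodType R := if n is m.+1 then res m V else V.

Definition ares_d V : diff (ares V) :=
  fun n => match n with 0 => aug V | m.+1 => res_d m V end.

Definition ares_map U V (f : {linear U -> V}) n :
  {linear ares U n -> ares V n} := if n is m.+1 then res_map m f else f.

Lemma ares_exact V : exact_cpx (ares_d V).
Proof.
split; first exact: aug_surj.
by case=> [|n] x; [apply: res_exact0|apply: res_exact].
Qed.

Lemma ares_proj V : proj_cpx (ares V).
Proof. by move=> n; apply: projective_free. Qed.

Lemma ares_map_chain U V (f : {linear U -> V}) :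
  chain_map (ares_d U) (ares_d V) (ares_map f).
Proof. by case=> [|n] x; [apply: aug_map|symmetry; apply: res_map_d]. Qed.

Lemma exact_dd Q (d : diff Q) : exact_cpx d -> forall n x, d n (d n.+1 x) = 0.
Proof. by move=> [_ ex] n x; apply/ex; exists x. Qed.

Variable X : lmodType R.

Definition cocycle Q (d : diff Q) n (c : {linear Q n.+1 -> X}) : Prop :=
  forall x, c (d n.+1 x) = 0.

(** In degree 0 the only coboundary is 0, as the augmentation is no part of the
    complex that computes Ext. *)
Definition coboundary Q (d : diff Q) n (c : {linear Q n.+1 -> X}) : Prop :=
  exists a : {linear Q n -> X},
    (n = 0%N -> forall x, a x = 0) /\ forall x, c x = a (d n x).

Lemma coboundary_cocycle Q (d : diff Q) n (c : {linear Q n.+1 -> X}) :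
  exact_cpx d -> coboundary d c -> cocycle d c.
Proof. by move=> ex [a [_ ca]] x; rewrite ca exact_dd // linear0. Qed.

Lemma coboundary_add Q (d : diff Q) n (b b' c : {linear Q n.+1 -> X}) :
  coboundary d b -> coboundary d b' -> (forall x, c x = b x + b' x) ->
  coboundary d c.
Proof.
move=> [a [a0 ba]] [a' [a0' ba']] cE; exists (a \+ a'); split=> [n0 x|x] /=.
  by rewrite a0 // a0' // addr0.
by rewrite cE ba ba'.
Qed.

Lemma coboundary_comp Q (d : diff Q) Q' (d' : diff Q') phi n
    (c : {linear Q' n.+1 -> X}) :
  chain_map d d' phi -> coboundary d' c -> coboundary d (c \o phi n.+1).
Proof.
move=> phiP [a [a0 ca]]; exists (a \o phi n); split=> [n0 x|x] /=; first exact: a0.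
by rewrite ca phiP.
Qed.

Lemma cocycle_comp Q (d : diff Q) Q' (d' : diff Q') phi n
    (c : {linear Q' n.+1 -> X}) :
  chain_map d d' phi -> cocycle d' c -> cocycle d (c \o phi n.+1).
Proof. by move=> phiP cc x; rewrite /= -phiP cc. Qed.

Lemma coboundary_homotopic Q (d : diff Q) Q' (d' : diff Q') phi psi n
    (c : {linear Q' n.+1 -> X}) :
  proj_cpx Q -> exact_cpx d -> exact_cpx d' ->
  chain_map d d' phi -> chain_map d d' psi -> phi 0%N = psi 0%N ->
  cocycle d' c -> coboundary d ((c \o phi n.+1) \- (c \o psi n.+1)).
Proof.
move=> pQ exQ exQ' phiP psiP e0 cc.
have [s [s0 sP]] := chain_homotopy pQ (exact_dd exQ) exQ' phiP psiP e0.
exists (c \o s n); split=> [n0 x|x] /=; last first.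
  by rewrite -linearB sP linearD cc add0r.
by case: n n0 c cc x => // _ c cc x; rewrite s0 linear0.
Qed.

(** The cocycle [c] represents [e]. The definition of Ext splits degree 0 from
    the others; through representatives all degrees are handled at once. *)
Definition Ext_rep V n : {linear res n V -> X} -> Ext X n V -> Prop :=
  match n with
  | 0 => fun c e => exists h : (c : coch X 0 V) \in ker (coch_d X 0 V),
           e = quot_pi (bound (\0 : {linear coch X 0 V -> coch X 0 V}) _)
             (exist (fun x => x \in ker (coch_d X 0 V)) (c : coch X 0 V) h)
  | m.+1 => fun c e => exists h : (c : coch X m.+1 V) \in ker (coch_d X m.+1 V),
           e = quot_pi (bound (coch_d X m V) _)
             (exist (fun x => x \in ker (coch_d X m.+1 V)) (c : coch X m.+1 V) h)
  end.

Lemma ker_coch V n (c : {linear res n V -> X}) :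
  (c : coch X n V) \in ker (coch_d X n V) <-> cocycle (ares_d V) (n := n) c.
Proof.
split=> [/kerP h x|h].
  exact: (congr1 (fun f : coch X n.+1 V => hom_fun f x) h).
by apply/kerP/hom_eqP => x; apply: h.
Qed.

Lemma Ext_rep_cocycle V n c e : @Ext_rep V n c e -> cocycle (ares_d V) (n := n) c.
Proof. by case: n c e => [|n] c e [h _]; apply/ker_coch. Qed.

Lemma Ext_rep_total V n c : cocycle (ares_d V) (n := n) c -> exists e, @Ext_rep V n c e.
Proof. by move/ker_coch; case: n c => [|n] c h; eexists; exists h; reflexivity. Qed.

Lemma Ext_rep_surj V n e : exists c, @Ext_rep V n c e.
Proof.
by case: n e => [|n] e; have [[c h] ->] := quot_pi_surj e; exists c, h.
Qed.

Lemma Ext_rep_linear V n r c c' e e' : @Ext_rep V n c e -> @Ext_rep V n c' e' ->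
  @Ext_rep V n ((r \*: c) \+ c') (r *: e + e').
Proof.
move=> ce ce'.
have /ker_coch : cocycle (ares_d V) (n := n) ((r \*: c) \+ c').
  by move=> x /=; rewrite (Ext_rep_cocycle ce) (Ext_rep_cocycle ce') scaler0 addr0.
case: n c c' e e' ce ce' => [|n] c c' e e' [h ->] [h' ->] hh; exists hh.
all: by rewrite -linearP; congr (quot_pi _ _); apply: val_inj.
Qed.

Lemma Ext_rep0 V n c e : @Ext_rep V n c e -> e = 0 <-> coboundary (ares_d V) (n := n) c.
Proof.
case: n c e => [|n] c e [h ->].
  split=> [|[a [a0 ca]]]; last first.
    rewrite -[RHS](linear0 (quot_pi _)); congr (quot_pi _ _); apply: val_inj.
    by apply: hom_eqP => x /=; rewrite -[LHS]/(c x) ca a0.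
  rewrite -[0](linear0 (quot_pi _)) => /quot_piP; rewrite subr0 => /asboolP[a ac].
  exists \0; split=> // x; rewrite -[LHS]/(hom_fun (c : coch X 0 V) x).
  by rewrite -[c : coch _ _ _]ac.
split=> [|[a [_ ca]]].
  rewrite -[0](linear0 (quot_pi _)) => /quot_piP; rewrite subr0 => /asboolP[a ac].
  exists a; split=> // x; rewrite -[LHS]/(hom_fun (c : coch X n.+1 V) x).
  by rewrite -[c : coch _ _ _]ac.
rewrite -[RHS](linear0 (quot_pi _)); apply/quot_piP; rewrite subr0.
apply/asboolP; exists (a : coch X n V); apply: hom_eqP => x.
by rewrite -[RHS]/(c x) ca.
Qed.

Lemma Ext_rep_map U V (f : {linear U -> V}) n c e : @Ext_rep V n c e ->
  @Ext_rep U n (c \o ares_map f n.+1) (Ext_map X n f e).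
Proof.
move=> ce; have /ker_coch : cocycle (ares_d U) (n := n) (c \o ares_map f n.+1).
  exact: cocycle_comp (ares_map_chain f) (Ext_rep_cocycle ce).
case: n c e ce => [|n] c e [h ->] hh; exists hh.
all: by rewrite /= quotmod_mapE; congr (quot_pi _ _); apply: val_inj.
Qed.

(** A cocycle on any projective resolution names an element of Ext, by transport
    along a comparison map; [represents_Ext_rep] shows that the choice of this
    map is immaterial. *)
Definition represents Q (d : diff Q) n (c : {linear Q n.+1 -> X})
    (e : Ext X n (Q 0%N)) : Prop :=
  cocycle d c /\ exists phi, [/\ chain_map (ares_d (Q 0%N)) d phi,
    phi 0%N = idfun & Ext_rep (c \o phi n.+1 : {linear res n _ -> X}) e].

Lemma eq_Ext_rep V n (c c' : {linear res n V -> X}) e :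
  c =1 c' -> Ext_rep c e -> Ext_rep c' e.
Proof. by move=> /linear_ext ->. Qed.

Lemma eq_represents Q (d : diff Q) n (c c' : {linear Q n.+1 -> X}) e :
  c =1 c' -> represents d c e -> represents d c' e.
Proof. by move=> /linear_ext ->. Qed.

Lemma Ext_rep_cohomologous V n (c c' : {linear res n V -> X}) e : cocycle (ares_d V) (n := n) c' ->
  coboundary (ares_d V) (n := n) (c \- c') -> @Ext_rep V n c e -> @Ext_rep V n c' e.
Proof.
move=> cc' cb ce; have [e' ce'] := Ext_rep_total cc'.
have /(eq_Ext_rep (c' := c \- c')) H := Ext_rep_linear (-1) ce' ce.
have [x|_ /(_ cb) /eqP] := Ext_rep0 (H _); first by rewrite /= scaleN1r addrC.
by rewrite scaleN1r addrC subr_eq0 => /eqP ->.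
Qed.

Lemma Ext_rep_homotopic V Q (d : diff Q) phi psi n (c : {linear Q n.+1 -> X}) e :
  exact_cpx d -> chain_map (ares_d V) d phi -> chain_map (ares_d V) d psi ->
  phi 0%N = psi 0%N -> cocycle d c ->
  @Ext_rep V n (c \o phi n.+1) e -> @Ext_rep V n (c \o psi n.+1) e.
Proof.
move=> exQ phiP psiP e0 cc; apply: Ext_rep_cohomologous.
  exact: (cocycle_comp psiP).
exact: (coboundary_homotopic (@ares_proj _) (ares_exact _) exQ phiP psiP e0 cc).
Qed.

Section Represents.
Variables (Q : nat -> lmodType R) (d : diff Q).
Hypotheses (projQ : proj_cpx Q) (exQ : exact_cpx d).

Lemma ares_lift : exists phi, chain_map (ares_d (Q 0%N)) d phi /\ phi 0%N = idfun.
Proof. exact: chain_lift (@ares_proj _) (exact_dd (ares_exact _)) exQ _. Qed.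

Lemma ares_colift : exists phi, chain_map d (ares_d (Q 0%N)) phi /\ phi 0%N = idfun.
Proof. exact: chain_lift projQ (exact_dd exQ) (ares_exact _) _. Qed.

Lemma represents_total n c : cocycle d (n := n) c -> exists e, represents d c e.
Proof.
move=> cc; have [phi [phiP phi0]] := ares_lift.
have [e ce] := Ext_rep_total (cocycle_comp phiP cc).
by exists e; split=> //; exists phi; split.
Qed.

Lemma represents_Ext_rep n c e phi : represents d (n := n) c e ->
  chain_map (ares_d (Q 0%N)) d phi -> phi 0%N = idfun ->
  @Ext_rep _ n (c \o phi n.+1) e.
Proof.
move=> [cc [psi [psiP psi0 ce]]] phiP phi0.
by apply: Ext_rep_homotopic exQ psiP phiP _ cc ce; rewrite phi0.
Qed.

Lemma represents_surj n (e : Ext X n (Q 0%N)) : exists c, represents d c e.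
Proof.
have [phi [phiP phi0]] := ares_lift; have [chi [chiP chi0]] := ares_colift.
have [c ce] := Ext_rep_surj e; have cc := Ext_rep_cocycle ce.
exists (c \o chi n.+1); split; first exact: (cocycle_comp chiP).
exists phi; split=> //.
have H := @Ext_rep_homotopic _ _ _ (fun=> idfun) (fun n => chi n \o phi n) n c e
  (ares_exact _) _ _ _ cc.
apply: (eq_Ext_rep _ (H _ _ _ _)) => //; last exact: eq_Ext_rep ce.
  by move=> m x /=; rewrite chiP phiP.
by apply: linear_ext => x; rewrite /= phi0 chi0.
Qed.

Lemma represents_linear n r c c' e e' :
  represents d (n := n) c e -> represents d c' e' ->
  represents d ((r \*: c) \+ c') (r *: e + e').
Proof.
move=> ce ce'; have [phi [phiP phi0]] := ares_lift; split.
  by move=> x /=; rewrite ce.1 ce'.1 scaler0 addr0.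
exists phi; split=> //; have := represents_Ext_rep ce phiP phi0.
move/Ext_rep_linear=> /(_ r _ _ (represents_Ext_rep ce' phiP phi0)).
exact: eq_Ext_rep.
Qed.

Lemma represents0 n c e : represents d (n := n) c e -> e = 0 <-> coboundary d c.
Proof.
move=> ce; have [cc [phi [phiP phi0 ce']]] := ce.
have [chi [chiP chi0]] := ares_colift.
split=> [/(Ext_rep0 ce') cb|cb]; last first.
  by apply/(Ext_rep0 ce'); apply: (coboundary_comp phiP).
apply: (coboundary_add (b := (c \o idfun) \- (c \o (phi n.+1 \o chi n.+1)))
  (b' := (c \o phi n.+1) \o chi n.+1)).
- apply: (@coboundary_homotopic _ d _ d (fun=> idfun) (fun n => phi n \o chi n)) => //.
    by move=> m x /=; rewrite phiP chiP.
  by apply: linear_ext => x; rewrite /= phi0 chi0.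
- exact: (coboundary_comp chiP cb).
by move=> x; rewrite /= subrK.
Qed.

Lemma represents_uniq n c e e' :
  represents d (n := n) c e -> represents d c e' -> e = e'.
Proof.
move=> ce ce'; have := represents_linear (-1) ce ce'.
move/represents0 => [_ H]; apply/eqP; rewrite -subr_eq0 -oppr_eq0 opprB.
rewrite addrC -scaleN1r; apply/eqP/H; exists \0; split=> // x /=.
by rewrite scaleN1r addNr.
Qed.

End Represents.

Lemma represents_map Q (d : diff Q) Q' (d' : diff Q') psi n
    (c : {linear Q' n.+1 -> X}) e :
  exact_cpx d -> exact_cpx d' -> chain_map d d' psi ->
  represents d' c e -> represents d (c \o psi n.+1) (Ext_map X n (psi 0%N) e).
Proof.
move=> exQ exQ' psiP ce; have cc := ce.1; split; first exact: (cocycle_comp psiP).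
have [phi [phiP phi0]] := ares_lift exQ; exists phi; split=> //.
have [phi' [phiP' phi0']] := ares_lift exQ'.
have := Ext_rep_map (psi 0%N) (represents_Ext_rep exQ' ce phiP' phi0').
have := @Ext_rep_homotopic (Q 0%N) _ d' (fun n => phi' n \o ares_map (psi 0%N) n)
  (fun n => psi n \o phi n) n c _ exQ' _ _ _ cc.
move=> H ce'; apply: (eq_Ext_rep _ (H _ _ _ _ (eq_Ext_rep _ ce'))) => //.
- by move=> m x /=; rewrite phiP' ares_map_chain.
- by move=> m x /=; rewrite psiP phiP.
- by apply: linear_ext => x; rewrite /= phi0 phi0'.
Qed.

Lemma represents_ares V n (e : Ext X n V) :
  exists c : {linear ares V n.+1 -> X}, represents (ares_d V) c e.
Proof. exact: represents_surj (@ares_proj V) (ares_exact V) n e. Qed.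

(** The map induced on free resolutions is not additive in [f]. But
    [r *: ares_map f + ares_map g] lifts [r *: f + g], and all lifts of a map
    induce the same map on Ext. *)
Lemma Ext_map_linear U V (f g : {linear U -> V}) r n e :
  Ext_map X n ((r \*: f) \+ g) e = r *: Ext_map X n f e + Ext_map X n g e.
Proof.
have [c ce] := represents_ares e; have exU := ares_exact U.
have exV := ares_exact V.
pose phi n : {linear ares U n -> ares V n} := (r \*: ares_map f n) \+ ares_map g n.
have phiP : chain_map (ares_d U) (ares_d V) phi.
  by move=> m x /=; rewrite linearP !ares_map_chain.
apply: (represents_uniq (@ares_proj U) exU (represents_map exU exV phiP ce)).
have := represents_linear exU r
  (represents_map exU exV (ares_map_chain f) ce)
  (represents_map exU exV (ares_map_chain g) ce).
by apply: eq_represents => x; rewrite /= linearP.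
Qed.

Lemma Ext_map_comp U V W (f : {linear U -> V}) (g : {linear V -> W}) n e :
  Ext_map X n (g \o f) e = Ext_map X n f (Ext_map X n g e).
Proof.
have [c ce] := represents_ares e; have exU := ares_exact U.
have exV := ares_exact V; have exW := ares_exact W.
pose phi n : {linear ares U n -> ares W n} := ares_map g n \o ares_map f n.
have phiP : chain_map (ares_d U) (ares_d W) phi.
  by move=> m x /=; rewrite !ares_map_chain.
apply: (represents_uniq (@ares_proj U) exU (represents_map exU exW phiP ce)).
have := represents_map exU exV (ares_map_chain f)
  (represents_map exV exW (ares_map_chain g) ce).
exact: eq_represents.
Qed.

Lemma Ext_map_id V n e : Ext_map X n (idfun : {linear V -> V}) e = e.
Proof.
have [c ce] := represents_ares e; have exV := ares_exact V.
have := represents_map (psi := fun=> idfun) exV exV _ ce.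
move=> /(_ (fun _ _ => erefl)) ce'.
apply: (represents_uniq (@ares_proj V) exV ce'); move: ce.
exact: eq_represents.
Qed.

Lemma Ext_map_scale V (f : {linear V -> V}) r n e :
  (forall x, f x = r *: x) -> Ext_map X n f e = r *: e.
Proof.
move=> fE; pose z : {linear V -> V} := \0.
have zz : ((-1) \*: z) \+ z = z :> {linear V -> V}.
  by apply: linear_ext => x; rewrite /= scaler0 addr0.
have z0 : Ext_map X n z e = 0.
  by rewrite -zz Ext_map_linear scaleN1r addNr.
have -> : f = (r \*: idfun) \+ z :> {linear V -> V}.
  by apply: linear_ext => x; rewrite fE /= addr0.
by rewrite Ext_map_linear z0 addr0 Ext_map_id.
Qed.

End Complexes.

(** * The long exact sequence of Ext in the first variable *)

Section Cone.
Variables (R : comNzRingType) (B C : lmodType R) (g : {linear B -> C}).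

Local Notation A := (submod (ker g)).
Local Notation f := (incl (ker g)).

(** The mapping cone of the resolution of [ker g] over that of [B]: for [g]
    surjective, it is a projective resolution of [C]. In contrast to a resolution
    built by the horseshoe lemma it involves no choice and is functorial in
    [g]. *)
Definition cone n : lmodType R :=
  match n with
  | 0 => C
  | 1 => res 0 B
  | m.+2 => (res m.+1 B * res m A)%type
  end.

Definition cone_step m (x : res m.+2 B * res m.+1 A) : (res m.+1 B * res m A)%type :=
  (res_d m.+1 B x.1 + res_map m.+1 f x.2, - res_d m A x.2).

Fact cone_step_linear m : linear (@cone_step m).
Proof.
move=> r x y; rewrite /cone_step !linearP; congr (_, _).
by rewrite /= scalerDr addrACA.
Qed.
HB.instance Definition _ m := GRing.isLinear.Build R (res m.+2 B * res m.+1 A)%type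
  (res m.+1 B * res m A)%type _ (@cone_step m) (@cone_step_linear m).

Definition cone_d : diff cone := fun n =>
  match n with
  | 0 => g \o aug B
  | 1 => copair (res_d 0 B) (res_map 0 f)
  | m.+2 => @cone_step m
  end.

Lemma cone_proj : proj_cpx cone.
Proof.
by case=> [|n]; [|apply: projective_prod]; apply: projective_free.
Qed.

Lemma cone_d1E b a : cone_d 1 (b, a) = res_d 0 B b + res_map 0 f a.
Proof. by []. Qed.

Lemma cone_d2E m b a :
  cone_d m.+2 (b, a) = (res_d m.+1 B b + res_map m.+1 f a, - res_d m A a).
Proof. by []. Qed.

Lemma cone_exact : surj g -> exact_cpx cone_d.
Proof.
move=> gS; have [augB exB] := ares_exact B; have [augA exA] := ares_exact A.
have dd0 x : aug B (res_d 0 B x) = 0 := @exact_dd _ _ _ (ares_exact B) 0%N x.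
have ddB n x : res_d n B (res_d n.+1 B x) = 0 := @exact_dd _ _ _ (ares_exact B) n.+1%N x.
have ddA n x : res_d n A (res_d n.+1 A x) = 0 := @exact_dd _ _ _ (ares_exact A) n.+1%N x.
have comm0 x : aug B (res_map 0 f x) = f (aug A x) := @ares_map_chain _ _ _ f 0%N x.
have comm n x : res_d n B (res_map n.+1 f x) = res_map n f (res_d n A x) :=
  @ares_map_chain _ _ _ f n.+1 x.
split=> [c|].
  by have [b <-] := gS c; have [x <-] := augB b; exists x.
case=> [|[|n]].
- move=> b; split=> [gb|[[b' a] <-]]; last first.
    rewrite cone_d1E -[LHS]/(g (aug B _)) linearD dd0 add0r comm0.
    by apply/kerP; exact: valP.
  have bk : aug B b \in ker g by apply/kerP.
  have [a aE] := augA (exist _ (aug B b) bk).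
  have [|b' b'E] := (exB 0%N (b - res_map 0 f a)).1.
    apply/eqP; rewrite linearB subr_eq0 -[X in _ == X]/(aug B _) comm0.
    by rewrite -[ares_d A 0]/(aug A) in aE; rewrite aE.
  exists (b', a); rewrite cone_d1E -[res_d 0 B b']/(ares_d B 1 b') b'E.
  exact: subrK.
- move=> [b a]; rewrite cone_d1E; split=> [ba|[[b' a']]]; last first.
    by rewrite cone_d2E => -[<- <-]; rewrite linearD ddB add0r linearN comm subrr.
  have fa : aug A a = 0.
    apply: val_inj; rewrite -[LHS]comm0 -[RHS](linear0 (aug B)) -ba.
    by rewrite linearD dd0 add0r.
  have [a' a'E] := (exA 0%N a).1 fa.
  have [|b' b'E] := (exB 1%N (b + res_map 1 f a')).1.
    rewrite linearD -[X in _ + X]/(res_d 0 B (res_map 1 f a')) comm.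
    by rewrite -[res_d 0 A a']/(ares_d A 1 a') a'E.
  exists (b', - a'); rewrite cone_d2E -[res_d 1 B b']/(ares_d B 2 b') b'E.
  rewrite linearN addrK linearN opprK.
  by rewrite -[res_d 0 A a']/(ares_d A 1 a') a'E.
move=> [b a]; rewrite cone_d2E; split=> [[ba /eqP]|[[b' a']]]; last first.
  rewrite cone_d2E => -[<- <-]; rewrite linearD ddB add0r linearN comm subrr.
  by rewrite linearN ddA !oppr0.
rewrite oppr_eq0 => /eqP fa; have [a' a'E] := (exA n.+1 a).1 fa.
have [|b' b'E] := (exB n.+2 (b + res_map n.+2 f a')).1.
  rewrite linearD -[X in _ + X]/(res_d n.+1 B (res_map n.+2 f a')) comm.
  by rewrite -[res_d n.+1 A a']/(ares_d A n.+2 a') a'E.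
exists (b', - a'); rewrite cone_d2E -[res_d n.+2 B b']/(ares_d B n.+3 b') b'E.
rewrite linearN addrK linearN opprK.
by rewrite -[res_d n.+1 A a']/(ares_d A n.+2 a') a'E.
Qed.

Definition cone_in n : {linear ares B n -> cone n} :=
  match n return {linear ares B n -> cone n} with
  | 0 => g
  | 1 => idfun
  | m.+2 => inl_lin (res m.+1 B) (res m A)
  end.

Lemma cone_in_chain : chain_map (ares_d B) cone_d cone_in.
Proof.
case=> [|[|n]] x //=; rewrite /copair /cone_step /= linear0 ?addr0 //.
by rewrite linear0 oppr0.
Qed.

End Cone.

Section ConeMap.
Variables (R : comNzRingType) (B C B' C' : lmodType R).
Variables (g : {linear B -> C}) (g' : {linear B' -> C'}).
Variables (u : {linear B -> B'}) (v : {linear C -> C'}).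
Hypothesis uv : forall x, g' (u x) = v (g x).

Lemma ker_square x : x \in ker g -> u x \in ker g'.
Proof. by move=> /kerP gx; apply/kerP; rewrite uv gx linear0. Qed.

Definition ker_map : {linear submod (ker g) -> submod (ker g')} :=
  submod_map ker_square.

Definition pair_lin (U V U' V' : lmodType R) (h : {linear U -> U'})
    (k : {linear V -> V'}) : {linear (U * V)%type -> (U' * V')%type} :=
  (inl_lin U' V' \o h \o fst_lin U V) \+ (inr_lin U' V' \o k \o snd_lin U V).

Lemma pair_linE (U V U' V' : lmodType R) (h : {linear U -> U'})
  (k : {linear V -> V'}) x y : pair_lin h k (x, y) = (h x, k y).
Proof. by congr (_, _); rewrite /= ?addr0 ?add0r. Qed.

Definition cone_map n : {linear cone g n -> cone g' n} :=
  match n return {linear cone g n -> cone g' n} with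
  | 0 => v
  | 1 => res_map 0 u
  | m.+2 => pair_lin (res_map m.+1 u) (res_map m ker_map)
  end.

Lemma res_map_incl n x : res_map n u (res_map n (incl (ker g)) x) =
  res_map n (incl (ker g')) (res_map n ker_map x).
Proof.
have free_sq (U V W W' : lmodType R) (a : {linear U -> V}) (b : {linear V -> W})
    (a' : {linear U -> W'}) (b' : {linear W' -> W}) :
    (forall x, b (a x) = b' (a' x)) ->
    forall x, free_map b (free_map a x) = free_map b' (free_map a' x).
  move=> ab; apply: (@free_ext _ _ _ (free_map b \o free_map a)
    (free_map b' \o free_map a')) => {}x /=.
  by rewrite !free_liftE !scale1r !free_liftE !scale1r ab.
rewrite /res_map; apply: (free_sq) => {}x.
elim: n x => [//|n IHn] x; apply: val_inj => /=.
exact: free_sq.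
Qed.

Lemma cone_map_chain : chain_map (cone_d g) (cone_d g') cone_map.
Proof.
case=> [|[|n]] x.
- by rewrite -[LHS]/(g' (aug B' (res_map 0 u x))) aug_map uv.
- case: x => b a; rewrite [cone_map 2 _]pair_linE !cone_d1E.
  rewrite -[RHS]/(res_map 0 u (res_d 0 B b + res_map 0 (incl (ker g)) a)).
  by rewrite linearD res_map_d res_map_incl.
case: x => b a; rewrite [cone_map n.+3 _]pair_linE !cone_d2E.
by rewrite [RHS]pair_linE linearD linearN !res_map_d res_map_incl.
Qed.

End ConeMap.

Section ConnectingMap.
Variables (R : comNzRingType) (X : lmodType R).
Implicit Types B C : lmodType R.

(** A cochain [a] on the resolution of the kernel that makes the restriction of
    [c] a coboundary is the missing component of [c] on the cone. *)
Lemma cone_extend B C (g : {linear B -> C}) n (c : {linear ares B n.+1 -> X}) :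
  cocycle (ares_d B) c ->
  coboundary (ares_d (submod (ker g))) (c \o ares_map (incl (ker g)) n.+1) ->
  exists2 c' : {linear cone g n.+1 -> X},
    cocycle (cone_d g) c' & c' \o cone_in g n.+1 =1 c.
Proof.
case: n c => [|n] c cc [a [a0 aE]].
  exists c => // -[b x]; rewrite [cone_d g 1 _]cone_d1E linearD.
  rewrite [X in X + _](cc b) add0r.
  by rewrite -[LHS]/((c \o ares_map (incl (ker g)) 1%N) x) aE a0.
exists (copair c a) => [[b x]|x].
  rewrite [cone_d g n.+2 _]cone_d2E.
  rewrite -[LHS]/(c (res_d n.+1 B b + res_map n.+1 (incl (ker g)) x)
    + a (- res_d n (submod (ker g)) x)) linearD.
  rewrite [X in X + _ + _](cc b) add0r linearN.
  by rewrite [X in X - _](aE x) subrr.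
by rewrite -[LHS]/(c x + a 0) linear0 addr0.
Qed.

Lemma cone_restrict0 B C (g : {linear B -> C}) (c : {linear cone g 1 -> X}) :
  coboundary (ares_d B) (n := 0) (c \o cone_in g 1) -> coboundary (cone_d g) c.
Proof.
move=> [a [a0 aE]]; exists \0; split=> // x.
by rewrite -[LHS]/((c \o cone_in g 1) x) aE a0.
Qed.

Definition cone_snd B C (g : {linear B -> C}) n
    (a : {linear res n (submod (ker g)) -> X}) : {linear cone g n.+2 -> X} :=
  a \o snd_lin (res n.+1 B) (res n (submod (ker g))).

Definition cone_fst B C (g : {linear B -> C}) n :
    {linear ares B n.+1 -> X} -> {linear cone g n.+1 -> X} :=
  match n return {linear ares B n.+1 -> X} -> {linear cone g n.+1 -> X} with
  | 0 => id
  | m.+1 => fun b => b \o fst_lin (res m.+1 B) (res m (submod (ker g)))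
  end.

Lemma cone_fst_d B C (g : {linear B -> C}) n (b : {linear ares B n.+1 -> X})
    (x : res n.+1 B) (y : res n (submod (ker g))) :
  cone_fst g b (cone_d g n.+1 (x, y)) = b (res_d n B x + res_map n (incl (ker g)) y).
Proof. by case: n b x y. Qed.

(** Subtracting the coboundary of [b] removes the component of [c] on the
    resolution of [B]. What is left factors through the resolution of the kernel,
    so its class comes from the connecting homomorphism. *)
Lemma cone_restrict B C (g : {linear B -> C}) n (c : {linear cone g n.+2 -> X}) :
  surj g -> cocycle (cone_d g) c -> coboundary (ares_d B) (n := n.+1) (c \o cone_in g n.+2) ->
  exists2 a : {linear ares (submod (ker g)) n.+1 -> X},
    cocycle (ares_d (submod (ker g))) a & coboundary (cone_d g) (c \- cone_snd a).
Proof.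
move=> gS cc [b [_ bE]].
pose a : {linear ares (submod (ker g)) n.+1 -> X} :=
  (c \o inr_lin (res n.+1 B) (res n _)) \- (b \o res_map n (incl (ker g))).
have ca : coboundary (cone_d g) (c \- cone_snd a).
  exists (cone_fst g b); split=> // -[x y]; rewrite cone_fst_d.
  rewrite -[LHS]/(c (x, y) - (c (0, y) - b (res_map n (incl (ker g)) y))).
  have -> : c (x, y) = c (x, 0) + c (0, y).
    by rewrite -linearD; congr (c (_, _)); rewrite /= ?addr0 ?add0r.
  rewrite [RHS]linearD -[X in _ = X + _]bE opprB addrACA [c (0, y) + _]addrC.
  by rewrite addrA subrK.
exists a => // y; have := coboundary_cocycle (cone_exact gS) ca (0, y).
rewrite [cone_d g n.+2 _]cone_d2E -cone_d2E -[LHS]/(c _ - a (- res_d n _ y)).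
by rewrite cc linearN opprK add0r.
Qed.

Lemma Ext_mid_exact B C (g : {linear B -> C}) n (e : Ext X n B) : surj g ->
  Ext_map X n (incl (ker g)) e = 0 -> exists e', Ext_map X n g e' = e.
Proof.
move=> gS e0; have exC := cone_exact gS.
have exB := ares_exact B; have exA := ares_exact (submod (ker g)).
have [c ce] := represents_ares e.
have cA := represents_map exA exB (ares_map_chain (incl (ker g))) ce.
have [/(_ e0) cb _] := represents0 (@ares_proj _ _) exA cA.
have [c' cc' c'E] := cone_extend ce.1 cb.
have [e' ce'] := represents_total exC cc'; exists e'.
have := represents_map exB exC (@cone_in_chain _ _ _ g) ce'.
move/(eq_represents c'E) => ce''.
exact: (represents_uniq (@ares_proj _ _) exB ce'' ce).
Qed.

Lemma Ext_map0_inj B C (g : {linear B -> C}) (e : Ext X 0 C) : surj g ->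
  Ext_map X 0 g e = 0 -> e = 0.
Proof.
move=> gS e0; have exC := cone_exact gS; have exB := ares_exact B.
have [c ce] := represents_surj (@cone_proj _ _ _ g) exC e.
have cB := represents_map exB exC (@cone_in_chain _ _ _ g) ce.
have [/(_ e0) cb _] := represents0 (@ares_proj _ _) exB cB.
by apply/(represents0 (@cone_proj _ _ _ g) exC ce)/cone_restrict0.
Qed.

(** The connecting homomorphism pulls cocycles back along the projection of the
    cone to the shifted resolution of the kernel. It is kept as a graph, since
    only its linearity, its single-valuedness and its naturality matter. *)
Definition connects B C (g : {linear B -> C}) n (e' : Ext X n (submod (ker g)))
    (e : Ext X n.+1 C) : Prop :=
  exists a : {linear ares (submod (ker g)) n.+1 -> X},
    represents (ares_d _) a e' /\ represents (cone_d g) (cone_snd a) e.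
Arguments connects {B C} g {n}.

Lemma connects_total B C (g : {linear B -> C}) n (e : Ext X n.+1 C) : surj g ->
  Ext_map X n.+1 g e = 0 -> exists e', connects g e' e.
Proof.
move=> gS e0; have exC := cone_exact gS; have exB := ares_exact B.
have [c ce] := represents_surj (@cone_proj _ _ _ g) exC e.
have cB := represents_map exB exC (@cone_in_chain _ _ _ g) ce.
have [/(_ e0) cb _] := represents0 (@ares_proj _ _) exB cB.
have [a ca caE] := cone_restrict gS ce.1 cb.
have [e' ae'] := represents_total (ares_exact _) ca.
exists e', a; split=> //.
have casnd : cocycle (cone_d g) (cone_snd a).
  move=> x; have := coboundary_cocycle exC caE x.
  by rewrite -[LHS]/(c _ - cone_snd a _) ce.1 sub0r => /eqP; rewrite oppr_eq0 => /eqP.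
have [e2 ae2] := represents_total exC casnd.
have := represents_linear exC (-1) ae2 ce.
move/(eq_represents (c' := c \- cone_snd a)) => H.
have [x|_ /(_ caE)] := represents0 (@cone_proj _ _ _ g) exC (H _).
  by rewrite /= scaleN1r addrC.
by move/eqP; rewrite scaleN1r addrC subr_eq0 => /eqP ->.
Qed.

Lemma connects_linear B C (g : {linear B -> C}) n r e1' e1 e2' e2 : surj g ->
  @connects B C g n e1' e1 -> connects g e2' e2 ->
  connects g (r *: e1' + e2') (r *: e1 + e2).
Proof.
move=> gS [a1 [a1' a1E]] [a2 [a2' a2E]]; exists ((r \*: a1) \+ a2); split.
  by have := represents_linear (ares_exact _) r a1' a2'; apply: eq_represents.
by have := represents_linear (cone_exact gS) r a1E a2E; apply: eq_represents.
Qed.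

Lemma connects0 B C (g : {linear B -> C}) n e : surj g ->
  @connects B C g n 0 e -> e = 0.
Proof.
move=> gS [a [a0 ae]]; apply/(represents0 (@cone_proj _ _ _ g) (cone_exact gS) ae).
have [/(_ erefl) [b [b0 bE]] _] := represents0 (@ares_proj _ _) (ares_exact _) a0.
case: n e a a0 ae b b0 bE => [|n] e a a0 ae b b0 bE.
  exists \0; split=> // x; rewrite -[LHS]/(a x.2).
  by rewrite bE b0.
exists ((-1) \*: cone_snd b); split=> // -[x y].
rewrite cone_d2E -[RHS]/(-1 *: b (- res_d n _ y)) linearN scaleN1r opprK.
exact: bE.
Qed.

Lemma connects_map B C (g : {linear B -> C}) B' C' (g' : {linear B' -> C'})
    (u : {linear B -> B'}) (v : {linear C -> C'})
    (uv : forall x, g' (u x) = v (g x)) n e' e :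
  surj g -> surj g' -> @connects B' C' g' n e' e ->
  connects g (Ext_map X n (ker_map uv) e') (Ext_map X n.+1 v e).
Proof.
move=> gS gS' [a [ae' ae]].
exists (a \o ares_map (ker_map uv) n.+1); split.
  exact: represents_map (ares_exact _) (ares_exact _) (ares_map_chain _) ae'.
have := represents_map (cone_exact gS) (cone_exact gS') (cone_map_chain uv) ae.
apply: eq_represents => -[x y].
by rewrite -[LHS]/(cone_snd a (cone_map uv n.+2 (x, y))) [cone_map _ _ _]pair_linE.
Qed.

End ConnectingMap.

Arguments connects {R X B C} g {n}.

(** * Generalized local cohomology as a functor *)

Lemma dirlim_desc (R : comNzRingType) (L : nat -> lmodType R)
    (phi : forall k, {linear L k -> L k.+1}) (W : lmodType R)
    (h : forall k, {linear L k -> W}) :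
  (forall k x, h k.+1 (phi k x) = h k x) ->
  exists H : {linear dirlim phi -> W}, forall k x, H (dirlim_in phi x) = h k x.
Proof.
move=> hphi.
have stable (s : prodmod L) K : (forall k, (K <= k)%N -> phi k (s k) = s k.+1) ->
    forall k, (K <= k)%N -> h k (s k) = h K (s K).
  move=> sK k /subnK <-; elim: (k - K)%N => [//|j IHj].
  by rewrite -IHj -[RHS]hphi sK // leq_addl.
pose rho t w := exists s : submod (coherent phi), quot_pi (vanishing phi) s = t /\
  exists K, forall k, (K <= k)%N -> h k (val s k) = w.
have rhoP r x y x' y' : rho x x' -> rho y y' -> rho (r *: x + y) (r *: x' + y').
  move=> [s [<- [K sK]]] [t [<- [K' tK]]]; exists (r *: s + t).
  rewrite linearP; split=> //; exists (maxn K K') => k.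
  rewrite geq_max => /andP[Kk Kk'].
  by rewrite -[X in h k X]/(r *: val s k + val t k) linearP sK // tK.
have rho0 y : rho 0 y -> y = 0.
  rewrite /rho -(linear0 (quot_pi (vanishing phi))).
  move=> [s [/quot_piP sv [K sK]]]; rewrite subr0 in sv.
  have /asboolP [K' s0] := sv.
  by rewrite -(sK (maxn K K')) ?leq_maxl // s0 ?leq_maxr // linear0.
have [t|H HP] := linear_of_rel rhoP rho0.
  have [s ->] := quot_pi_surj t; have /asboolP [K sK] := valP s.
  by exists (h K (val s K)), s; split=> //; exists K; apply: stable.
exists H => k x; apply: (linear_rel_uniq rhoP rho0 (HP _)).
exists (exist _ (dirlim_seq phi x) (dirlim_seq_coherent phi x)); split=> //.
exists k => j kj; rewrite (stable (dirlim_seq phi x) k) //.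
  by rewrite (dirlim_seqE phi x 0).
by move=> i; apply: dirlim_seqS.
Qed.

Section Functor.
Variables (R : comNzRingType) (I : ideal R).
Implicit Types U V W : lmodType R.

Definition pq_class V k : {linear V -> pow_quot I V k} := quot_pi (powsub I V k).

Lemma pq_class_surj V k : surj (@pq_class V k).
Proof. by move=> y; have [x ->] := quot_pi_surj y; exists x. Qed.

Lemma pq_class0 V k x : pq_class V k x = 0 <-> x \in powsub I V k.
Proof.
by rewrite -(linear0 (pq_class V k)) (quot_piP (powsub I V k) x 0) subr0.
Qed.

Definition pq_tr V k m (km : (k <= m)%N) :
    {linear pow_quot I V m -> pow_quot I V k} :=
  quotmod_map (f := idfun) (powsub_mono (I := I) (V := V) km).

Lemma pq_trE V k m (km : (k <= m)%N) x :
  pq_tr V km (pq_class V m x) = pq_class V k x.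
Proof. exact: quotmod_mapE. Qed.

Definition pq_map U V (f : {linear U -> V}) k :
    {linear pow_quot I U k -> pow_quot I V k} :=
  quotmod_map (f := f) (fun x => @powsub_map R I U V f k x).

Lemma pq_mapE U V (f : {linear U -> V}) k x :
  pq_map f k (pq_class U k x) = pq_class V k (f x).
Proof. exact: quotmod_mapE. Qed.

Lemma pq_map_surj U V (f : {linear U -> V}) k : surj f -> surj (pq_map f k).
Proof.
move=> fS y; have [v <-] := pq_class_surj y; have [u <-] := fS v.
by exists (pq_class U k u); rewrite pq_mapE.
Qed.

Lemma pq_ext V k W (f g : {linear pow_quot I V k -> W}) :
  (forall x, f (pq_class V k x) = g (pq_class V k x)) -> f =1 g.
Proof. by move=> fg y; have [x <-] := pq_class_surj y. Qed.

Lemma pq_tr_map U V (f : {linear U -> V}) k m (km : (k <= m)%N) x :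
  pq_tr V km (pq_map f m x) = pq_map f k (pq_tr U km x).
Proof.
apply: (pq_ext (f := pq_tr V km \o pq_map f m) (g := pq_map f k \o pq_tr U km)).
by move=> {}x /=; rewrite pq_mapE !pq_trE pq_mapE.
Qed.

Lemma pq_tr_comp V k m l (km : (k <= m)%N) (ml : (m <= l)%N) (kl : (k <= l)%N) x :
  pq_tr V km (pq_tr V ml x) = pq_tr V kl x.
Proof.
apply: (pq_ext (f := pq_tr V km \o pq_tr V ml) (g := pq_tr V kl)).
by move=> {}x; rewrite -[LHS]/(pq_tr V km (pq_tr V ml _)) !pq_trE.
Qed.

Variable X : lmodType R.

Definition glc_in V i k : {linear Ext X i (pow_quot I V k) -> glc I V X i} :=
  @dirlim_in R (fun k => Ext X i (pow_quot I V k))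
    (fun k => Ext_map X i (pow_quot_map I V k)) k.

Lemma glc_trans V i k j (e : Ext X i (pow_quot I V k)) :
  trans (fun k => Ext_map X i (pow_quot_map I V k)) j e =
  Ext_map X i (pq_tr V (leq_addl j k)) e.
Proof.
elim: j => [|j IHj] /=.
  rewrite -[LHS](Ext_map_id (V := pow_quot I V k)); congr (Ext_map X i _ e).
  by apply/linear_ext/pq_ext => x; rewrite pq_trE.
rewrite IHj -Ext_map_comp; congr (Ext_map X i _ e); apply/linear_ext/pq_ext => x.
rewrite [RHS]pq_trE -(pq_trE (leq_addl j k)).
have E := quotmod_mapE (@pow_quot_sub R I V (j + k)) x.
exact: (congr1 (pq_tr V (leq_addl j k)) E).
Qed.

Lemma glc_in_surj V i (t : glc I V X i) : exists k e, glc_in V i k e = t.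
Proof. exact: dirlim_in_surj. Qed.

Lemma glc_in_tr V i k m (km : (k <= m)%N) e :
  glc_in V i m (Ext_map X i (pq_tr V km) e) = glc_in V i k e.
Proof.
have [j jm] : exists j, m = (j + k)%N by exists (m - k)%N; rewrite subnK.
subst m; rewrite (eq_irrelevance km (leq_addl j k)) -glc_trans.
by elim: j {km} => [//|j IHj]; rewrite -IHj; apply: dirlim_in_eq.
Qed.

Lemma glc_in0 V i k e : glc_in V i k e = 0 <->
  exists m (km : (k <= m)%N), Ext_map X i (pq_tr V km) e = 0.
Proof.
split=> [/dirlim_in0 [j je]|[m [km e0]]]; last by rewrite -(glc_in_tr km) e0 linear0.
by exists (j + k)%N, (leq_addl j k); rewrite -glc_trans.
Qed.

Lemma glc_map_exists U V (f : {linear U -> V}) i :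
  exists H : {linear glc I V X i -> glc I U X i},
    forall k e, H (glc_in V i k e) = glc_in U i k (Ext_map X i (pq_map f k) e).
Proof.
apply: (@dirlim_desc R _ _ _ (fun k => glc_in U i k \o Ext_map X i (pq_map f k))).
move=> k e; rewrite -[RHS](glc_in_tr (leqnSn k)).
rewrite -[LHS]/(glc_in U i k.+1 _); congr (glc_in U i k.+1 _).
rewrite -!Ext_map_comp; congr (Ext_map X i _ e); apply/linear_ext/pq_ext => x.
rewrite -[RHS]/(pq_map f k (pq_tr U _ _)) pq_trE pq_mapE.
rewrite -[LHS]/(pow_quot_map I V k (pq_map f k.+1 _)) pq_mapE.
exact: quotmod_mapE.
Qed.

Definition glc_map U V (f : {linear U -> V}) i : {linear glc I V X i -> glc I U X i} :=
  projT1 (cid (glc_map_exists f i)).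

Lemma glc_mapE U V (f : {linear U -> V}) i k e :
  glc_map f i (glc_in V i k e) = glc_in U i k (Ext_map X i (pq_map f k) e).
Proof. by rewrite /glc_map; case: cid. Qed.

Lemma glc_map_comp U V W (f : {linear U -> V}) (g : {linear V -> W}) i t :
  glc_map (g \o f) i t = glc_map f i (glc_map g i t).
Proof.
have [k [e <-]] := glc_in_surj t; rewrite !glc_mapE -Ext_map_comp.
congr (glc_in _ _ _ (Ext_map X i _ e)); apply/linear_ext/pq_ext => x.
by rewrite pq_mapE -[RHS]/(pq_map g k (pq_map f k _)) !pq_mapE.
Qed.

Lemma glc_map_add U V (f g h : {linear U -> V}) i t :
  (forall x, h x = f x + g x) -> glc_map h i t = glc_map f i t + glc_map g i t.
Proof.
move=> hE; have [k [e <-]] := glc_in_surj t; rewrite !glc_mapE -linearD.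
congr (glc_in _ _ _ _); rewrite -[X in X + _]scale1r -Ext_map_linear.
congr (Ext_map X i _ e); apply/linear_ext/pq_ext => x.
rewrite -[RHS]/(1 *: pq_map f k _ + pq_map g k _) scale1r !pq_mapE hE.
exact: linearD.
Qed.

Lemma glc_map_comp0 U V W (f : {linear U -> V}) (g : {linear V -> W}) i t :
  glc_map g i t = 0 -> glc_map (g \o f) i t = 0.
Proof. by move=> gt; rewrite glc_map_comp gt; exact: linear0. Qed.

Lemma glc_map_add0 U V (f g h : {linear U -> V}) i t :
  (forall x, h x = f x + g x) -> glc_map f i t = 0 -> glc_map g i t = 0 ->
  glc_map h i t = 0.
Proof. by move=> hE ft gt; rewrite (glc_map_add t hE) ft gt addr0. Qed.

Lemma glc_map_scale V (f : {linear V -> V}) r i t :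
  (forall x, f x = r *: x) -> glc_map f i t = r *: t.
Proof.
move=> fE; have [k [e <-]] := glc_in_surj t; rewrite glc_mapE -linearZ.
congr (glc_in _ _ _ _); apply: Ext_map_scale => y; have [x <-] := pq_class_surj y.
by rewrite pq_mapE fE linearZ.
Qed.

(** [I ^ k] kills [V / I ^ k V], and a scalar acts on Ext through either
    argument. *)
Lemma glc_torsion V i : torsion (glc I V X i) I.
Proof.
move=> t; have [k [e <-]] := glc_in_surj t; exists k => r rI.
rewrite -linearZ -(@Ext_map_scale _ _ _ \0 r) //; last first.
  move=> y; have [x <-] := pq_class_surj y; rewrite -linearZ; symmetry.
  by apply/pq_class0; apply: idealM_mem.
rewrite (@Ext_map_scale _ _ _ \0 0) ?scale0r ?linear0 // => y.
by rewrite scale0r.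
Qed.

(** * The long exact sequence up to a Serre subcategory *)

Section Exact.
Variables (U V W : lmodType R) (f : {linear U -> V}) (g : {linear V -> W}).
Hypotheses (fI : injective f) (gS : surj g).
Hypothesis fg : forall x, g x = 0 <-> exists y, f y = x.
Hypotheses (nR : noetherian R) (nV : noeth V).

(** The kernel at level [l] is [U] modulo the preimage of [I ^ l V]. By the
    Artin-Rees property this preimage lies in [I ^ m U] for large [l], so the
    kernels and the quotients [U / I ^ m U] have the same colimits. *)
Lemma ker_pq_factor m : exists l (ml : (m <= l)%N)
    (w : {linear submod (ker (pq_map g l)) -> pow_quot I U m}),
  forall x, pq_map f m (w x) = pq_tr V ml (val x).
Proof.
have [l ml AR] := artin_rees I m nR nV fI; exists l, ml.
pose rho (z : submod (ker (pq_map g l))) (y : pow_quot I U m) :=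
  exists u, val z = pq_class V l (f u) /\ y = pq_class U m u.
have [||z|w wP] := @linear_of_rel _ _ _ rho.
- move=> r z z' _ _ [u [zu ->]] [u' [zu' ->]]; exists (r *: u + u').
  by rewrite !linearP -zu -zu'.
- move=> _ [u [/esym/pq_class0/AR u0 ->]]; exact/pq_class0.
- have [x xz] := pq_class_surj (val z).
  have /kerP := valP z; rewrite -xz pq_mapE => /pq_class0 gx.
  have [x' x'l gx'] := powsub_surj gS gx.
  have [|u fu] := (fg (x - x')).1; first by rewrite linearB gx' subrr.
  exists (pq_class U m u), u; split=> //; rewrite -xz fu linearB.
  by rewrite ((pq_class0 l x').2 x'l) subr0.
exists w => z; have [u [-> ->]] := wP z.
by rewrite pq_mapE pq_trE.
Qed.

Lemma glc_mid_exact i t : glc_map f i t = 0 -> exists s, glc_map g i s = t.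
Proof.
have [k [e <-]] := glc_in_surj t; rewrite glc_mapE => /glc_in0 [m [km e0]].
have [l [ml [w wP]]] := ker_pq_factor m; have kl := leq_trans km ml.
have [|e' e'E] := Ext_mid_exact (e := Ext_map X i (pq_tr V kl) e)
  (pq_map_surj (k := l) gS).
  rewrite -Ext_map_comp -[RHS](linear0 (Ext_map X i w)) -e0 -!Ext_map_comp.
  congr (Ext_map X i _ e); apply: linear_ext => x.
  rewrite -[LHS]/(pq_tr V kl (val x)) -(pq_tr_comp km ml) -wP.
  exact: pq_tr_map.
by exists (glc_in W i l e'); rewrite glc_mapE e'E glc_in_tr.
Qed.

Lemma glc_map0_inj t : glc_map g 0 t = 0 -> t = 0.
Proof.
have [k [e <-]] := glc_in_surj t; rewrite glc_mapE => /glc_in0 [m [km e0]].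
apply/glc_in0; exists m, km; apply: Ext_map0_inj (pq_map_surj (k := m) gS) _.
rewrite -e0 -!Ext_map_comp; congr (Ext_map X 0 _ e); apply: linear_ext => x.
exact: pq_tr_map.
Qed.

Lemma ker_pq_map k : exists v : {linear pow_quot I U k -> submod (ker (pq_map g k))},
  forall x, val (v x) = pq_map f k x.
Proof.
apply: corestrict => x; have [u <-] := pq_class_surj x; apply/kerP.
by rewrite !pq_mapE (fg (f u)).2 ?linear0 //; exists u.
Qed.

Variable C : lmodType R -> Prop.
Hypothesis Cserre : serre C.

(** The kernel is the image of [H^i(U)] under the connecting homomorphism. The
    relation [rhoat l] is its graph, taken at level [l]: it starts from a class
    [e'] of the kernel of [pq_map g l], read in [H^i(U)] by pulling it back to
    [U / I ^ l U]. This pullback becomes invertible in the colimit, by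
    [ker_pq_factor]; hence a class related to 0 vanishes at a higher level. *)
Lemma serre_ker_glc_map i :
  C (glc I U X i) -> C (submod (ker (glc_map g i.+1))).
Proof.
have [v vE] : exists v : forall k, {linear pow_quot I U k -> submod (ker (pq_map g k))},
    forall k x, val (v k x) = pq_map f k x.
  exists (fun k => projT1 (cid (ker_pq_map k))) => k; by case: cid.
have sqr k m (km : (k <= m)%N) x :
    pq_map g k (pq_tr V km x) = pq_tr W km (pq_map g m x) := esym (pq_tr_map g km x).
pose rhoat l (t : glc I W X i.+1) (s : glc I U X i) := exists e e',
  [/\ t = glc_in W i.+1 l e, s = glc_in U i l (Ext_map X i (v l) e')
    & connects (pq_map g l) e' e].
have rho_up l m t s : (l <= m)%N -> rhoat l t s -> rhoat m t s.
  move=> lm [e [e' [-> -> ee']]].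
  exists (Ext_map X i.+1 (pq_tr W lm) e), (Ext_map X i (ker_map (sqr _ _ lm)) e').
  rewrite glc_in_tr; split=> //; last first.
    by apply: connects_map ee'; apply: pq_map_surj.
  rewrite -(glc_in_tr lm) -!Ext_map_comp.
  congr (glc_in _ _ _ (Ext_map X i _ e')); apply: linear_ext => x; apply: val_inj.
  rewrite -[LHS]/(val (v l (pq_tr U lm x))) vE.
  by rewrite -[RHS]/(pq_tr V lm (val (v m x))) vE pq_tr_map.
apply: (serre_rel Cserre (rho := fun (t : submod (ker (glc_map g i.+1))) s =>
    exists l, rhoat l (val t) s)) => //.
- move=> r t t' s s' [l ts] [l' ts']; exists (maxn l l').
  have [e1 [e1' [t1 -> c1]]] := rho_up _ _ _ _ (leq_maxl l l') ts.
  have [e2 [e2' [t2 -> c2]]] := rho_up _ _ _ _ (leq_maxr l l') ts'.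
  exists (r *: e1 + e2), (r *: e1' + e2'); split.
  - by rewrite [RHS]linearP -t1 -t2.
  - by rewrite !linearP.
  - by apply: connects_linear c1 c2; apply: pq_map_surj.
- move=> t; have [k [e et]] := glc_in_surj (val t).
  have /kerP := valP t; rewrite -et glc_mapE => /glc_in0 [l [kl e0]].
  have [|e' ee'] := @connects_total _ X _ _ (pq_map g l) i
    (Ext_map X i.+1 (pq_tr W kl) e) (pq_map_surj gS).
    rewrite -e0 -!Ext_map_comp; congr (Ext_map X i.+1 _ e); apply: linear_ext => x.
    exact: pq_tr_map.
  exists (glc_in U i l (Ext_map X i (v l) e')), l, (Ext_map X i.+1 (pq_tr W kl) e), e'.
  by split=> //; rewrite glc_in_tr et.
move=> t [l [e [e' [te s0 ee']]]]; apply: val_inj; rewrite te [RHS]linear0.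
have /glc_in0 [m [lm e'0]] := esym s0.
have [q [mq [w wE]]] := ker_pq_factor m; have lq := leq_trans lm mq.
apply/glc_in0; exists q, lq.
have := connects_map (sqr _ _ lq) (pq_map_surj gS) (pq_map_surj gS) ee'.
suff -> : Ext_map X i (ker_map (sqr l q lq)) e' = 0.
  by apply: connects0; apply: pq_map_surj.
rewrite -[RHS](linear0 (Ext_map X i w)) -e'0 -!Ext_map_comp.
congr (Ext_map X i _ e'); apply: linear_ext => x; apply: val_inj.
rewrite -[LHS]/(pq_tr V lq (val x)) -(pq_tr_comp lm mq) -wE.
by rewrite -[RHS]/(val (v l (pq_tr U lm (w x)))) vE pq_tr_map.
Qed.

End Exact.
End Functor.

(** * A nonzero map to a residue domain *)

(** Induction on the number of generators of [V]. Let [V0] be generated by all of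
    them but the first one, [v]. If every [x] with [x v] in [V0] lies in [p], then
    [V / V0] is a quotient of [R] that maps onto [R / p]. Otherwise some [x]
    outside [p] maps [V] into [V0]; as [x Ann V0] is contained in [Ann V], the
    induction hypothesis gives a nonzero map on [V0], and composing it with [x]
    keeps it nonzero, since [R / p] is a domain. *)
Lemma hom_to_residue_domain (R : comNzRingType) (p : ideal R) r (V : lmodType R)
    (q : {linear ringpow R r -> V}) :
  (1 : R) \notin p -> (forall x y : R, x * y \in p -> x \in p \/ y \in p) ->
  surj q -> {subset Ann V <= p} ->
  exists (f : {linear V -> quotmod p}) (v : V), f v <> 0.
Proof.
move=> p1 pP; have one0 : quot_pi p (1 : R^o) <> 0.
  by rewrite -(linear0 (quot_pi p)) => /quot_piP; rewrite subr0; apply/negP.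
have pi0 (x : R^o) : quot_pi p x = 0 <-> x \in p.
  by rewrite -(linear0 (quot_pi p)) quot_piP subr0.
elim: r V q => [|r IHr] V q qS annV.
  have [u qu|f fE] := @linear_factor _ _ _ _ q (quot_pi p) qS.
    apply/pi0/annV/asboolP => v; have [w <-] := qS v.
    have uw : (u : R) *: w = (w : R) *: u := @mulrC R u w.
    have quw : q ((w : R) *: u) = 0 by rewrite linearZ /= qu scaler0.
    by rewrite -quw -uw linearZ.
  by exists f, (q 1); rewrite fE.
pose q0 : {linear ringpow R r -> V} := q \o inr_lin R^o (ringpow R r).
pose q1 : {linear R^o -> V} := q \o inl_lin R^o (ringpow R r).
have qE x u : q (x, u) = q1 x + q0 u.
  rewrite -[RHS](linearD q); congr (q (_, _)); by rewrite /= ?addr0 ?add0r.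
case: (pselect (forall x, q1 x \in im q0 -> x \in p)) => [inp|].
  have [[x u] qu|f fE] := @linear_factor _ _ _ _ q (quot_pi p \o fst_lin _ _) qS.
    apply/pi0/inp/imP; exists (- u); rewrite linearN.
    by apply/eqP; rewrite eq_sym -addr_eq0 -qE qu.
  by exists f, (q (1, 0)); rewrite fE.
move=> ninp; have [x xq xp] : exists2 x, q1 x \in im q0 & x \notin p.
  apply: contrapT => nx; apply: ninp => x xq; apply: contrapT => /negP xp.
  by apply: nx; exists x.
have xV v : (x : R) *: v \in im q0.
  have [[y u] <-] := qS v; rewrite qE scalerDr; apply: rpredD.
    have xy : (x : R) *: y = (y : R) *: x := @mulrC R x y.
    have -> : (x : R) *: q1 y = (y : R) *: q1 x.
      have q1Z (a : R) b : q1 (a *: b) = a *: q1 b by rewrite linearZ.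
      by rewrite -q1Z xy q1Z.
    exact: rpredZ.
  by apply: rpredZ; apply/imP; exists u.
have [q' q'E] := @corestrict _ _ _ (im q0) q0 (fun u => introT (imP _ _) (ex_intro _ u erefl)).
have [s sE] := @corestrict _ _ _ (im q0) ((x : R) \*: idfun) xV.
have [y|y /asboolP ay|f [w fw]] := IHr _ q'.
- by have /imP [u uy] := valP y; exists u; apply: val_inj; rewrite q'E.
- have [|//|] := pP y x; last by move=> xp'; rewrite xp' in xp.
  apply/annV/asboolP => v.
  have vV := xV v; rewrite -scalerA.
  pose w : submod (im q0) := exist (fun z => z \in im q0) ((x : R) *: v) vV.
  exact: (congr1 (incl (im q0)) (ay w)).
exists (f \o s), (val w) => fs; apply: fw.
have {}fs : f (x *: w) = 0 by rewrite -fs; congr (f _); apply: val_inj; rewrite sE.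
have [z zE] := quot_pi_surj (f w).
have piZ (a : R) (b : R^o) : quot_pi p (a *: b) = a *: quot_pi p b by rewrite linearZ.
have /pi0 xz : quot_pi p ((x : R) *: z : R^o) = 0 by rewrite piZ -zE -linearZ.
have [xp'|zp] := pP x z xz; first by rewrite xp' in xp.
by rewrite zE; apply/pi0.
Qed.

(** * Transfer of membership between modules *)

Section Transfer.
Variables (R : comNzRingType) (I : ideal R) (X : lmodType R).
Variable C : lmodType R -> Prop.
Hypotheses (Cserre : serre C) (nR : noetherian R).
Implicit Types U V W : lmodType R.

Lemma fg_regular : fg (R^o : lmodType R).
Proof. by exists 0%N, idfun => x; exists x. Qed.

Lemma glc_mid_mem U V W (f : {linear U -> V}) (g : {linear V -> W}) i :
  injective f -> surj g -> (forall x, g x = 0 <-> exists y, f y = x) -> fg V ->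
  C (glc I W X i) -> C (glc I U X i) -> C (glc I V X i).
Proof.
move=> fI gS fg0 /(fg_noeth nR) nV CW CU.
apply: (serre_mid Cserre (f := glc_map I X g i) (g := glc_map I X f i)) => // t.
exact: glc_mid_exact.
Qed.

(** The induction hypothesis on the cohomological degree: below [i], all modules
    may be neglected. *)
Definition all_below i : Prop :=
  forall j, (j < i)%N -> forall V, fg V -> C (glc I V X j).

(** Left exactness of [H^i] modulo [C], once the lower degrees are in [C]. *)
Lemma serre_ker_glc_surj V W (g : {linear V -> W}) i :
  all_below i -> fg V -> surj g -> C (submod (ker (glc_map I X g i))).
Proof.
move=> low /(fg_noeth nR) nV gS.
have gker x : g x = 0 <-> exists y, incl (ker g) y = x.
  split=> [/kerP gx|[y <-]]; first by exists (exist _ x gx).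
  by apply/kerP; exact: valP.
case: i low => [|i] low.
  have [[Z CZ] _] := Cserre; apply: (serre_sub Cserre (f := \0)) CZ.
  apply: inj_ker0 => x _; apply: val_inj; rewrite [RHS]linear0.
  by apply: (glc_map0_inj gS); apply/kerP; exact: valP.
apply: (serre_ker_glc_map val_inj gS gker nR nV Cserre).
by apply: low => //; apply: nV.
Qed.

Lemma glc_surj_mem V W (g : {linear V -> W}) i :
  all_below i -> fg V -> surj g -> C (glc I V X i) -> C (glc I W X i).
Proof.
move=> low fgV gS; apply: (serre_ker Cserre (f := glc_map I X g i)).
exact: serre_ker_glc_surj.
Qed.

(** A finitely generated [V] is a quotient of some [R^r], and [H^i(R^r)] is an
    iterated extension of copies of [H^i(R)]. *)
Lemma glc_fg_mem i : all_below i -> C (glc I R^o X i) ->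
  forall V, fg V -> C (glc I V X i).
Proof.
move=> low CR V [r [q qS]]; apply: (glc_surj_mem low _ qS).
  by exists r, idfun => x; exists x.
elim: r {q qS} => [//|r IHr].
apply: (glc_mid_mem (f := inr_lin R^o (ringpow R r)) (g := fst_lin R^o (ringpow R r))) => //.
- by move=> x y [].
- by move=> x; exists (x, 0).
- move=> [x y]; split=> /= [->|[z [<- _]] //]; by exists y.
by exists r.+1, idfun => x; exists x.
Qed.

Lemma quot_ideal0 (J : ideal R) (x : R^o) : quot_pi J x = 0 <-> x \in J.
Proof. by rewrite -(linear0 (quot_pi J)) quot_piP subr0. Qed.

Lemma fg_cyclic (J : ideal R) : fg (quotmod J).
Proof.
apply: (fg_quot (f := quot_pi J)) fg_regular => y.
by have [x ->] := quot_pi_surj y; exists x.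
Qed.

(** The image of a nonzero map from [M] to [R / p] is [J / p] for an ideal [J]
    strictly above [p]. Then [H^i(J / p)] is controlled by [H^i(M)], as [J / p] is
    a quotient of [M], and [H^i(R / J)] is in [C] by assumption. *)
Lemma glc_residue_domain (M : lmodType R) i (p : ideal R) :
  all_below i -> fg M -> C (glc I M X i) -> {subset Ann M <= p} ->
  (1 : R) \notin p -> (forall x y : R, x * y \in p -> x \in p \/ y \in p) ->
  (forall J : ideal R, {subset p <= J} -> (exists2 y, y \in J & y \notin p) ->
     C (glc I (quotmod J) X i)) ->
  C (glc I (quotmod p) X i).
Proof.
move=> low fgM CM annM p1 pP IH; have [r [q qS]] := fgM.
have [f [v fv]] := hom_to_residue_domain p1 pP qS annM.
have [J JE] : exists J : ideal R, forall x, (x \in J) = (quot_pi p x \in im f).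
  by exists (preim_sub (quot_pi p) (im f)).
have piJ : {subset p <= J}.
  by move=> x xp; rewrite JE (quot_ideal0 p x).2 // rpred0.
pose g : {linear quotmod p -> quotmod J} := quotmod_map (f := idfun) piJ.
have gE x : g (quot_pi p x) = quot_pi J x := quotmod_mapE (f := idfun) piJ x.
apply: (glc_mid_mem (f := incl (im f)) (g := g)) => //.
- exact: val_inj.
- by move=> y; have [x ->] := quot_pi_surj y; exists (quot_pi p x).
- move=> y; have [x ->] := quot_pi_surj y; rewrite gE quot_ideal0; split=> [xJ|[z zE]].
    by rewrite JE in xJ; exists (exist (fun y => y \in im f) (quot_pi p x) xJ).
  by rewrite JE -zE; exact: valP.
- exact: fg_cyclic.
- apply: IH => //; have [x xE] := quot_pi_surj (f v); exists x.
    by rewrite JE -xE; apply/imP; exists v.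
  by apply/negP => /quot_ideal0; rewrite -xE.
have [h hE] := @corestrict _ _ _ (im f) f (fun u => introT (imP _ _) (ex_intro _ u erefl)).
apply: (glc_surj_mem low fgM (g := h)) => // y.
by have /imP [u uy] := valP y; exists u; apply: val_inj; rewrite hE.
Qed.

(** Noetherian induction on [J], as for a prime filtration of [R / J]: if [J] is
    proper and not prime, say [y x] is in [J] with [x] and [y] outside, then
    [R / J] is an extension of [R / (J + (x))] by [R / (J : x)], and both ideals
    are strictly larger than [J]. *)
Lemma glc_cyclic_mem (M : lmodType R) i : all_below i -> fg M ->
  C (glc I M X i) ->
  forall J : ideal R, {subset Ann M <= J} -> C (glc I (quotmod J) X i).
Proof.
move=> low fgM CM; apply: (ideal_ind nR) => J IH annJ.
have {}IH (K : ideal R) : {subset J <= K} -> (exists2 y, y \in K & y \notin J) ->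
    C (glc I (quotmod K) X i).
  by move=> JK yK; apply: IH => // x /annJ /JK.
have [J1|J1] := boolP ((1 : R) \in J).
  apply: (glc_surj_mem low fgM (g := \0)) CM => y; exists 0.
  have [x ->] := quot_pi_surj y; symmetry; apply/quot_ideal0.
  by have := @ideal_mulr R J 1 x J1; rewrite mulr1.
case: (pselect (exists x y : R, [/\ x \notin J, y \notin J & y * x \in J])); last first.
  move=> nz; apply: (glc_residue_domain low fgM CM annJ J1) => // x y xy.
  apply: contrapT => nxy; apply: nz; exists y, x; split=> //; apply/negP => ?;
    apply: nxy; by [left|right].
move=> [x [y [xJ yJ yx]]].
have fP z : z \in colon J x -> scale_at (x : R^o) z \in J by [].
pose f : {linear quotmod (colon J x) -> quotmod J} :=
  quotmod_map (f := scale_at (x : R^o)) fP.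
pose g : {linear quotmod J -> quotmod (adjoin J x)} :=
  quotmod_map (f := idfun) (@sub_adjoin R J x).
have fE z : f (quot_pi _ z) = quot_pi J (scale_at (x : R^o) z) := 
  quotmod_mapE (f := scale_at (x : R^o)) fP z.
have gE z : g (quot_pi J z) = quot_pi _ z := 
  quotmod_mapE (f := idfun) (@sub_adjoin R J x) z.
apply: (glc_mid_mem (f := f) (g := g)).
- apply: inj_ker0 => z; have [u ->] := quot_pi_surj z.
  by rewrite fE => /quot_ideal0 uJ; apply/quot_ideal0.
- by move=> z; have [u ->] := quot_pi_surj z; exists (quot_pi J u).
- move=> z; have [u ->] := quot_pi_surj z; rewrite gE quot_ideal0.
  split=> [/adjoinP [w wJ [r ->]]|[w]].
    exists (quot_pi _ (r : R^o)); rewrite fE; apply/quot_piP.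
    by rewrite opprD addrCA subrr addr0 rpredN.
  have [r ->] := quot_pi_surj w; rewrite fE => /quot_piP ru; apply/adjoinP.
  by exists (u - r * x); [rewrite -rpredN opprB|exists r; rewrite subrK].
- exact: fg_cyclic.
- by apply: IH; [exact: sub_adjoin|exists x => //; apply: mem_adjoin].
- by apply: IH; [move=> z zJ; apply: ideal_mull|exists y].
Qed.

(** [H^i] turns the matrix of [q] into multiplication by its entries. *)
Lemma glc_map_kill r (q : {linear ringpow R r -> R^o}) i (t : glc I R^o X i) :
  (forall u, (q u : R) *: t = 0) -> glc_map I X q i t = 0.
Proof.
elim: r q => [|r IHr] q qt.
  rewrite -(qt 1); apply: (@glc_map_scale _ _ X R^o q (q 1)) => x.
  have qx : q ((x : R) *: (1 : R^o)) = (x : R) *: q 1 by rewrite linearZ.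
  by rewrite [_ *: _](mulr1 (x : R)) in qx; rewrite qx; apply: (@mulrC R).
pose q1 : {linear ringpow R 0 -> R^o} := q \o inl_lin R^o (ringpow R r).
pose q0 : {linear ringpow R r -> R^o} := q \o inr_lin R^o (ringpow R r).
have q1t : glc_map I X q1 i t = 0.
  rewrite -(qt (1, 0)); apply: (@glc_map_scale _ _ X R^o q1 (q (1, 0))) => x.
  have q1x : q1 ((x : R) *: (1 : R^o)) = (x : R) *: q1 1 by rewrite linearZ.
  by rewrite [_ *: _](mulr1 (x : R)) in q1x; rewrite q1x; apply: (@mulrC R).
have q0t : glc_map I X q0 i t = 0 by apply: IHr => u; exact: qt.
have qE u : q u = (q1 \o fst_lin R^o (ringpow R r)) u + (q0 \o snd_lin R^o (ringpow R r)) u.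
  case: u => x u; rewrite -[RHS](linearD q).
  by congr (q (_, _)); rewrite /= ?addr0 ?add0r.
exact: (glc_map_add0 qE (glc_map_comp0 _ q1t) (glc_map_comp0 _ q0t)).
Qed.

(** Generators of [I] give a map [R^r -> R] with image [I], and it induces 0 on
    the elements of [H^i(R)] killed by [I]. So [H^i(R) -> H^i(I)] maps these
    elements into the kernel of [H^i(I) -> H^i(R^r)], which is in [C]; and the
    kernel of [H^i(R) -> H^i(I)] is covered by [H^i(R / I)]. *)
Lemma glc_colon0_mem i : all_below i -> C (glc I (quotmod I) X i) ->
  C (submod (colon0 (glc I R^o X i) I)).
Proof.
move=> low CRI; have [r [q qS]] := noeth_ringpow (r := 0) nR I.
apply: (serre_mid_sub Cserre (f := glc_map I X (quot_pi I) i)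
  (g := glc_map I X (incl I) i) (T := ker (glc_map I X q i))) CRI _.
- move=> t; apply: (@glc_mid_exact _ _ _ _ _ _ (incl I)).
  + exact: val_inj.
  + by move=> y; have [x ->] := quot_pi_surj y; exists x.
  + move=> x; rewrite quot_ideal0; split=> [xI|[y <-]]; last exact: valP.
    by exists (exist _ x xI).
  + exact: nR.
  + exact: (fg_noeth nR fg_regular).
- move=> t /asboolP tI; apply/kerP; rewrite -glc_map_comp.
  apply: glc_map_kill => u; apply: tI; exact: valP.
by apply: serre_ker_glc_surj => //; exists r, idfun => x; exists x.
Qed.

End Transfer.

(** * The main equivalence *)

Section Annihilator.
Variables (R : comNzRingType) (a : ideal R) (M : lmodType R).

Lemma AnnP (r : R) : reflect (forall v : M, r *: v = 0) (r \in Ann M).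
Proof. exact: asboolP. Qed.

Lemma sub_idealD : {subset Ann M <= idealD a (Ann M)}.
Proof.
move=> r rM; apply/asboolP; exists 0, r; rewrite add0r; split=> //.
exact: rpred0.
Qed.

Lemma ideal_powD_Ann k :
  {subset ideal_pow (idealD a (Ann M)) k <= idealD (ideal_pow a k) (Ann M)}.
Proof.
elim: k => [|k IHk].
  by move=> r _; apply/asboolP; exists r, 0; rewrite addr0; split=> //; apply: rpred0.
apply: idealM_sub => s t /asboolP[x [n [xa nM ->]]] /IHk /asboolP[y [m [ya mM ->]]].
apply/asboolP; exists (x * y), (n * (y + m) + x * m); split.
- exact: idealM_mem.
- by apply: (@rpredD _ (Ann M)); [exact: (@ideal_mull R (Ann M) n (y + m) nM)|exact: (@ideal_mulr R (Ann M) m x mM)].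
by rewrite -[LHS]/((x + n) * (y + m)) mulrDl mulrDr addrAC -addrA.
Qed.

Lemma powsub_idealD_Ann k : powsub a M k =i powsub (idealD a (Ann M)) M k.
Proof.
have mono j : {subset ideal_pow a j <= ideal_pow (idealD a (Ann M)) j}.
  elim: j => [//|j IHj]; apply: idealM_sub => s t sa ta; apply: idealM_mem.
    by apply/asboolP; exists s, 0; rewrite addr0; split=> //; apply: rpred0.
  exact: IHj.
move=> v; apply/idP/idP; apply: idealM_sub => r w rI _.
  by apply: idealM_mem => //; apply: mono.
have /asboolP[x [n [xa /AnnP nM ->]]] := ideal_powD_Ann rI.
by rewrite scalerDl nM addr0; apply: idealM_mem.
Qed.

End Annihilator.

Lemma eq_submodule (R : comNzRingType) (V : lmodType R) (S T : submodule V) :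
  S =i T -> S = T.
Proof.
case: S T => [S Scl] [T Tcl] ST; have e : S = T by apply/funext => x; apply: ST.
by subst T; congr Submodule; apply: Prop_irrelevance.
Qed.

Lemma eq_glc (R : comNzRingType) (I J : ideal R) (M X : lmodType R) i :
  (forall k, powsub I M k =i powsub J M k) -> glc I M X i = glc J M X i.
Proof.
move=> eIJ.
pose lim (F : nat -> submodule M) (H : forall k x, x \in F k.+1 -> idfun x \in F k) :=
  @dirlim R (fun k => Ext X i (quotmod (F k)))
    (fun k => Ext_map X i (quotmod_map (f := idfun) (H k) : {linear _ -> _})).
have lim_eq F F' H H' : F = F' -> lim F H = lim F' H'.
  by move=> e; subst F'; congr (lim F _); apply: Prop_irrelevance.
apply: (lim_eq (powsub I M) (powsub J M)).
by apply/funext => k; apply: eq_submodule.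
Qed.

Section Equivalence.
Variables (R : comNzRingType) (I : ideal R) (M X : lmodType R).
Variable C : lmodType R -> Prop.
Hypotheses (nR : noetherian R) (fgM : fg M) (CI : melkersson C I).
Hypothesis annI : {subset Ann M <= I}.

Lemma all_below_regular n :
  (forall i, (i < n)%N -> C (glc I R^o X i)) -> all_below I X C n.
Proof.
have [Cserre _] := CI; elim: n => [//|n IHn] CR j; rewrite ltnS leq_eqVlt.
have low : all_below I X C n by apply: IHn => i lt_in; apply: CR; apply: ltnW.
case/orP=> [/eqP-> V fgV|]; last exact: low.
by apply: (glc_fg_mem Cserre nR low _ fgV); apply: CR.
Qed.

(** The only place where the Melkersson condition enters. *)
Lemma glc_regular_mem i :
  all_below I X C i -> C (glc I M X i) -> C (glc I R^o X i).
Proof.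
have [Cserre Cmel] := CI; move=> low CM; apply: Cmel; first exact: glc_torsion.
apply: (glc_colon0_mem Cserre nR low).
exact: (glc_cyclic_mem Cserre nR low fgM CM annI).
Qed.

Lemma glc_mem_iff n :
  (forall i, (i <= n)%N -> C (glc I R^o X i)) <->
  (forall i, (i <= n)%N -> C (glc I M X i)).
Proof.
split=> CH i lein.
  apply: (@all_below_regular i.+1) => // j; rewrite ltnS => leji.
  by apply: CH; apply: leq_trans lein.
elim/ltn_ind: i lein => i IHi lein; apply: glc_regular_mem; last exact: CH.
apply: all_below_regular => j ltji; apply: IHi => //.
exact: leq_trans (ltnW ltji) lein.
Qed.

End Equivalence.

Theorem corollary2p14 (R : comNzRingType) (a : ideal R) (M X : lmodType R)
    (n : nat) (C : lmodType R -> Prop) :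
  noetherian R -> fin_gen M -> melkersson C (idealD a (Ann M)) ->
  ((forall i, (i <= n)%N -> C (lc (idealD a (Ann M)) X i)) <->
   (forall i, (i <= n)%N -> C (glc a M X i))) /\
  ((forall i, C (lc (idealD a (Ann M)) X i)) <->
   (forall i, C (glc a M X i))).
Proof.
move=> nR /fin_gen_fg fgM CI.
have glcE i : glc a M X i = glc (idealD a (Ann M)) M X i.
  by apply: eq_glc; apply: powsub_idealD_Ann.
have iff m := glc_mem_iff X nR fgM CI (@sub_idealD R a M) m.
split; split=> CH i.
- by move=> lein; rewrite glcE; apply: (iff n).1.
- by apply: (iff n).2 i => j lejn; rewrite -glcE; apply: CH.
- by rewrite glcE; apply: (iff i).1 => // j _; apply: CH.
by apply: (iff i).2 => // j _; rewrite -glcE; apply: CH.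
Qed.
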